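(* Assume $d\geq 3$ and let $a,b>0$ be arbitrary. Then there exist $\epsilon_{b,a}>0$ and $\eta_{b,a}>0$ such that, for all $N$ large enough, \[ \tilde P_{N,a,b}\big(\tilde\xi_N>\epsilon_{b,a}N^d\ \big|\ \Omega_N^+\big)\ \geq\ 1-\exp(-\eta_{b,a}N^d). \]
   Context: Let $\Lambda_N=\{-\lfloor N/2\rfloor,\dots,\lfloor N/2\rfloor\}^d\subset\mathbb{Z}^d$ with outer boundary $\partial\Lambda_N$ (points of $\mathbb{Z}^d\setminus\Lambda_N$ at distance $1$ from $\Lambda_N$). For $\phi\in\mathbb{R}^{\mathbb{Z}^d}$ let $H(\phi)=\frac{1}{8d}\sum_{x,y\in \Lambda_N\cup\partial\Lambda_N,\ |x-y|=1}(\phi_x-\phi_y)^2$ (sum over ordered pairs). Define the probability measure \[ \tilde P_{N,a,b}(d\phi)=\frac{1}{\tilde Z_{N,a,b}}\exp\Big(-H(\phi)+b\sum_{x\in\Lambda_N}\mathbf{1}_{\{\phi_x\in[0,a]\}}\Big)\prod_{x\in\Lambda_N}d\phi_x\ \delta_0(d\phi_{\Lambda_N^c}), \] i.e. $\phi_x=0$ for $x\notin\Lambda_N$, with $\tilde Z_{N,a,b}$ the normalizing constant. Let $\tilde\xi_N=\sum_{x\in\Lambda_N}\mathbf{1}_{\{\phi_x\in[0,a]\}}$ and $\Omega_N^+=\{\phi_x\geq 0\ \forall x\in\Lambda_N\}$. *)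

(* Defs.v *)
From HB Require Import structures.
From mathcomp Require Import all_boot all_order all_algebra.
From mathcomp Require Import all_classical all_reals all_analysis.
Set Implicit Arguments. Unset Strict Implicit. Unset Printing Implicit Defensive.
Import Order.TTheory GRing.Theory Num.Theory.
Local Open Scope ring_scope.

Definition site (d : nat) := {ffun 'I_d -> int}.

Definition field (R : realType) (d : nat) := site d -> R.

(* Lambda_N = {-floor(N/2), ..., floor(N/2)}^d, as a duplicate-free list. *)
Definition box (d m : nat) : seq (site d) :=
  [seq [ffun i => (nat_of_ord (f i))%:Z - m%:Z] | f : {ffun 'I_d -> 'I_(m.*2.+1)} <- enum [set: {ffun 'I_d -> 'I_(m.*2.+1)}]].

Definition Lam (d N : nat) : seq (site d) := box d N./2.

Definition dist2 d (x y : site d) : int := \sum_(i < d) (x i - y i) ^+ 2.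

(* Lambda_N together with its outer boundary (points at distance 1 from Lambda_N);
   all of these lie in the box of radius floor(N/2)+1. *)
Definition LamBd (d N : nat) : seq (site d) :=
  [seq x <- box d (N./2).+1 | (x \in Lam d N) || has (fun y => dist2 x y == 1) (Lam d N)].

Definition Ham (R : realType) d N (phi : field R d) : R :=
  (8 * d%:R)^-1 * \sum_(x <- LamBd d N) \sum_(y <- LamBd d N | dist2 x y == 1)
     (phi x - phi y) ^+ 2.

Definition xi (R : realType) d N (a : R) (phi : field R d) : nat :=
  (\sum_(x <- Lam d N) nat_of_bool ((0 <= phi x) && (phi x <= a))%R)%N.

Definition weight (R : realType) d N (a b : R) (phi : field R d) : R :=
  expR (- Ham N phi + b * (xi N a phi)%:R).

Definition upd (R : realType) d (phi : field R d) (x : site d) (t : R) : field R d :=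
  fun z => if z == x then t else phi z.

(* Iterated Lebesgue integral over the coordinates listed in s, all other
   coordinates being pinned to 0 (the delta_0 boundary condition).
   For s duplicate-free this is integration against prod_{x in s} d phi_x. *)
Fixpoint iint (R : realType) d (s : seq (site d)) (F : field R d -> \bar R) : \bar R :=
  match s with
  | [::] => F (fun _ => 0)
  | x :: s' => (\int[@lebesgue_measure R]_t iint s' (fun phi => F (upd phi x t)))%E
  end.

Definition Zmass (R : realType) d N (a b : R) (A : set (field R d)) : \bar R :=
  iint (Lam d N) (fun phi => ((\1_A phi : R) * weight N a b phi)%:E).

Definition Ptilde (R : realType) d N (a b : R) (A : set (field R d)) : R :=
  fine (Zmass N a b A) / fine (Zmass N a b (@setT (field R d))).

Definition Pcond (R : realType) d N (a b : R) (A B : set (field R d)) : R :=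
  Ptilde N a b (A `&` B)%classic / Ptilde N a b B.

Definition OmegaPlus (R : realType) d N : set (field R d) :=
  [set phi | forall x, x \in Lam d N -> 0 <= phi x].

(* Main.v *)
(* It suffices to bound the partition function with wall and pinning from below
   by [e^(c N^d)] times the free one: on [xi <= eps N^d] the pinning gains at most
   [e^(b eps N^d)].

   The field is raised by a constant [h] on the whole box, at the cost of a
   surface term. The precision matrix of the free field is [I - P], with [P] the
   random walk kernel, and [2 - (I - P) = I + P] is a sum of squares
   [(phi_x + phi_y)^2] over edges; linearizing these squares exhibits the free
   field as a mixture of products of Gaussians [N(m_x, 1/2)]. Given the [m_x] the
   sites are independent, and Jensen's inequality over the mixture bounds the
   partition function below by the exponential of a sum of one-site expectations.

   At one site let [G] be the variance of the free field. The factor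
   [1_{t >= 0} e^(b 1_{[0, a]})] has Gaussian average above [1] as soon as the
   conditional mean [m_x + h] is large, because the well has mass of order
   [e^(- m^2)] and the half-line [t < 0] a smaller one. The average gain is of
   order [e^(- h^2 / 2G)], whereas [m_x] has variance [G - 1/2], so the loss from
   small [m_x + h] is of order [e^(- h^2 / (2G - 1))], negligible for large [h].
   Dimension three enters only in that [G] is bounded uniformly in [N]. *)

Require Import Defs.
From HB Require Import structures.
From mathcomp Require Import all_boot all_order all_algebra.
From mathcomp Require Import all_classical all_reals all_analysis.
From mathcomp Require Import measurable_realfun.
From mathcomp Require Import ring lra zify.
Set Implicit Arguments. Unset Strict Implicit. Unset Printing Implicit Defensive.
Import Order.TTheory GRing.Theory Num.Theory.
Import numFieldNormedType.Exports.
Local Open Scope classical_set_scope.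
Local Open Scope ring_scope.

(** * Iterated Lebesgue integrals *)

Section translation.
Variable R : realType.
Notation mu := (@lebesgue_measure R).

(** Jensen's inequality is applied without conditional expectations. The exponent of the one-site
    bound depends on the conditional mean, and to be averaged over the mixture it is written as a
    Gaussian average in the site variable itself, that of [th - rho]; its mean is then an integral
    against the one-site marginal of the free field, and the law of the mixing variables never
    appears. This is why losses are majorized by exponentials [rho], whose averages under both
    Gaussians are explicit. The exponential in Jensen's bound is replaced by its tangent at a level
    [T] fixed in advance: the result is an inequality between integrals of nonnegative functions,
    linear in the measure, and such an inequality survives mixing. Boundary sites, where raising the
    field leaves a linear term, receive a crude one-site factor with a bounded loss. *)

Lemma measurable_shift (c : R) : measurable_fun setT (fun t : R => t + c).
Proof. apply: measurable_realfun.measurable_funD => //; exact: measurable_id. Qed.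

Lemma lebesgue_measure_shift (c : R) (A : set R) : measurable A ->
  pushforward mu ((fun t => t + c) : _ -> measurableTypeR R) A = mu A.
Proof.
move=> mA; apply/esym/lebesgue_measure_unique => //=.
  exact: measurable_shift.
move=> ? _ [[a b]] _ <-.
rewrite /pushforward.
have -> : (fun t : R => t + c) @^-1` `]a, b] = `](a - c), (b - c)]%classic.
  by apply/seteqP; split => t /=; rewrite !in_itv/= ltrBlDr lerBrDr.
rewrite !lebesgue_measure_itv/= !lte_fin ltrBlDr subrK.
by case: ifP => // _; rewrite -!EFinB opprB addrA subrK.
Qed.

Lemma ge0_integral_shift (c : R) (g : R -> \bar R) :
  measurable_fun setT g -> (forall t, 0 <= g t)%E ->
  (\int[mu]_t g (t + c)%R = \int[mu]_t g t)%E.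
Proof.
move=> mg g0.
have := @ge0_integral_pushforward _ _ (measurableTypeR R) (measurableTypeR R) R
  (fun t => t + c) (measurable_shift c) mu setT g measurableT mg.
rewrite preimage_setT => <-; last by move=> t _.
apply: eq_measure_integral => [|mf A mA _]; first exact: measurable_shift.
exact: lebesgue_measure_shift.
Qed.

End translation.

Section iterated_integral.
Variables (R : realType) (d : nat).
Notation mu := (@lebesgue_measure R).
Notation field := (field R d).
Implicit Types (s : seq (site d)) (F G : field -> \bar R) (x : site d).

(* Measurability of functions of the field is tested on all coordinatewise
   measurable families of fields; this avoids a sigma-algebra on [field], and it is
   stable under integrating out one coordinate, by Tonelli. *)
Definition fmeas F := forall d1 (T1 : measurableType d1) (u : T1 -> field),
  (forall z, measurable_fun setT (fun t => u t z)) ->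
  measurable_fun setT (fun t => F (u t)).

(** Integrating out a coordinate turns it into a parameter, so the test families move parameter and
    field together. *)
Definition jmeas d0 (T : measurableType d0) (G : T -> field -> \bar R) :=
  forall d1 (T1 : measurableType d1) (v : T1 -> T) (u : T1 -> field),
  measurable_fun setT v -> (forall z, measurable_fun setT (fun t => u t z)) ->
  measurable_fun setT (fun t => G (v t) (u t)).

Lemma jmeas_upd F x : fmeas F ->
  jmeas (fun (t : measurableTypeR R) phi => F (upd phi x t)).
Proof.
move=> mF d1 T1 v u mv mu_; apply: mF => z; rewrite /upd.
by case: (z == x).
Qed.

Lemma jmeas_upd2 d0 (T : measurableType d0) (G : T -> field -> \bar R) x :
  jmeas G ->
  jmeas (fun (p : T * measurableTypeR R) phi => G p.1 (upd phi x p.2)).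
Proof.
move=> mG d1 T1 v u mv mu_.
apply: (mG _ _ (fun t => (v t).1) (fun t => upd (u t) x (v t).2)) => [|z].
  exact: (measurableT_comp measurable_fst mv).
rewrite /upd; case: (z == x) => //.
exact: (measurableT_comp measurable_snd mv).
Qed.

Lemma jmeas_slice d0 (T : measurableType d0) (G : T -> field -> \bar R) t :
  jmeas G -> fmeas (G t).
Proof. by move=> mG d1 T1 u mu_; apply: mG. Qed.

Lemma fmeas_upd F x t : fmeas F -> fmeas (fun phi => F (upd phi x t)).
Proof. by move=> mF; exact: (jmeas_slice t (jmeas_upd x mF)). Qed.

Lemma iint_ge0 s F : (forall phi, 0 <= F phi)%E -> (0 <= iint s F)%E.
Proof.
elim: s F => [|x s IH] F F0 //=.
by apply: integral_ge0 => t _; apply: IH.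
Qed.

(** The parameter space is generalized in the induction: the coordinate being integrated joins it,
    and Tonelli's theorem handles the outer integral. *)
Lemma measurable_iint s d0 (T : measurableType d0) (G : T -> field -> \bar R) :
  (forall t phi, 0 <= G t phi)%E -> jmeas G ->
  measurable_fun setT (fun t => iint s (G t)).
Proof.
elim: s d0 T G => [|x s IH] d0 T G G0 mG /=; first exact: mG.
have := IH _ _ (fun (p : T * measurableTypeR R) phi => G p.1 (upd phi x p.2))
  (fun _ _ => G0 _ _) (jmeas_upd2 x mG).
move=> mp.
apply: (@measurable_fun_fubini_tonelli_F _ _ T (measurableTypeR R) R mu
  (fun p => iint s (fun phi => G p.1 (upd phi x p.2)))) => // p.
exact: iint_ge0.
Qed.

Lemma measurable_iint_upd s F x : (forall phi, 0 <= F phi)%E -> fmeas F ->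
  measurable_fun setT
    (fun t : measurableTypeR R => iint s (fun phi => F (upd phi x t))).
Proof. by move=> F0 mF; apply: measurable_iint => //; apply: jmeas_upd. Qed.

Lemma eq_iint s F G : (forall phi, F phi = G phi) -> iint s F = iint s G.
Proof. by move=> /funext ->. Qed.

(** The integrand is only ever evaluated at the zero field updated along [s], hence at fields that
    vanish off [s]. This is how the zero boundary condition enters the later estimates. *)
Lemma eq_iint_supp s F G :
  (forall phi : field, (forall z, z \notin s -> phi z = 0) -> F phi = G phi) ->
  iint s F = iint s G.
Proof.
elim: s F G => [|x s IH] F G FG /=; first exact: FG.
apply: eq_integral => t _; apply: IH => phi phi0; apply: FG => z.
by rewrite inE negb_or /upd => /andP[/negPf -> /phi0].
Qed.

Lemma le_iint s F G : (forall phi, 0 <= F phi)%E -> (forall phi, 0 <= G phi)%E ->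
  fmeas F -> fmeas G ->
  (forall phi : field, (forall z, z \notin s -> phi z = 0) ->
    (F phi <= G phi)%E) ->
  (iint s F <= iint s G)%E.
Proof.
elim: s F G => [|x s IH] F G F0 G0 mF mG FG /=; first exact: FG.
apply: ge0_le_integral => //.
- by move=> t _; apply: iint_ge0.
- exact: measurable_iint_upd.
- exact: measurable_iint_upd.
- move=> t _; apply: IH => //; try exact: fmeas_upd.
  move=> phi phi0; apply: FG => z.
  by rewrite inE negb_or /upd => /andP[/negPf -> /phi0].
Qed.

Lemma iintD s F G : (forall phi, 0 <= F phi)%E -> (forall phi, 0 <= G phi)%E ->
  fmeas F -> fmeas G ->
  (iint s (fun phi => F phi + G phi) = iint s F + iint s G)%E.
Proof.
elim: s F G => [|x s IH] F G F0 G0 mF mG //=.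
rewrite -ge0_integralD//; last 4 first.
- by move=> t _; apply: iint_ge0.
- exact: measurable_iint_upd.
- by move=> t _; apply: iint_ge0.
- exact: measurable_iint_upd.
by apply: eq_integral => t _; rewrite IH//; exact: fmeas_upd.
Qed.

Lemma iintZl s F (k : R) : (0 <= k)%R -> (forall phi, 0 <= F phi)%E -> fmeas F ->
  (iint s (fun phi => k%:E * F phi) = k%:E * iint s F)%E.
Proof.
move=> k0; elim: s F => [|x s IH] F F0 mF //=.
rewrite -ge0_integralZl_EFin//; last 2 first.
- by move=> t _; apply: iint_ge0.
- exact: measurable_iint_upd.
by apply: eq_integral => t _; rewrite IH//; exact: fmeas_upd.
Qed.

Lemma iint_integral s (G : measurableTypeR R -> field -> \bar R) :
  (forall t phi, 0 <= G t phi)%E -> jmeas G ->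
  (iint s (fun phi => \int[mu]_t G t phi) = \int[mu]_t iint s (G t))%E.
Proof.
elim: s G => [|x s IH] G G0 mG //=.
transitivity (\int[mu]_r \int[mu]_t iint s (fun phi => G t (upd phi x r)))%E.
  apply: eq_integral => r _; rewrite IH// => d1 T1 v u mv mu_.
  by apply: mG => // z; rewrite /upd; case: (z == x).
apply: (@fubini_tonelli _ _ (measurableTypeR R) (measurableTypeR R) R mu mu
  (fun p => iint s (fun phi => G p.2 (upd phi x p.1)))) => [|p].
  apply: measurable_iint => // d1 T1 v u mv mu_.
  apply: mG => [|z]; first exact: (measurableT_comp measurable_snd mv).
  rewrite /upd; case: (z == x) => //.
  exact: (measurableT_comp measurable_fst mv).
by apply: iint_ge0.
Qed.

Lemma updC (phi : field) x y t r : x != y ->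
  upd (upd phi x t) y r = upd (upd phi y r) x t.
Proof.
move=> xy; apply/funext => z; rewrite /upd.
by case: eqP => // ->; rewrite eq_sym (negPf xy).
Qed.

Lemma iint_front s F x : (forall phi, 0 <= F phi)%E -> fmeas F ->
  uniq s -> x \in s -> iint s F = iint (x :: rem x s) F.
Proof.
elim: s F => [//|y s IH] F F0 mF /= /andP[ys us].
rewrite inE; have [->//|xy /= xs] := eqVneq x y.
under eq_integral do rewrite (IH _ _ (fmeas_upd _ _ mF))//=.
rewrite (@fubini_tonelli _ _ (measurableTypeR R) (measurableTypeR R) R mu mu
  (fun p => iint (rem x s) (fun phi => F (upd (upd phi x p.2) y p.1))))/=.
- by under eq_integral do under eq_integral do under eq_iint do rewrite updC//.
- apply: measurable_iint => // d1 T1 v u mv mu_.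
  apply: mF => z; rewrite /upd; case: (z == y).
    exact: (measurableT_comp measurable_fst mv).
  case: (z == x) => //.
  exact: (measurableT_comp measurable_snd mv).
- by move=> p; apply: iint_ge0.
Qed.

(** Translation invariance of Lebesgue measure, one coordinate at a time; off [s] the field is
    pinned and cannot be moved. *)
Lemma iint_translate s F (w : field) : (forall phi, 0 <= F phi)%E -> fmeas F ->
  (forall z, z \notin s -> w z = 0) ->
  iint s F = iint s (fun phi => F (phi + w)).
Proof.
elim: s F w => [|x s IH] F w F0 mF w0 /=.
  by congr F; apply/funext => z /=; rewrite fctE w0 ?addr0.
rewrite -(ge0_integral_shift (w x) (measurable_iint_upd s x F0 mF)); last first.
  by move=> t; apply: iint_ge0.
apply: eq_integral => t _.
(* The head coordinate is already translated, so the induction hypothesis takes [w] with its value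
   at [x] erased. *)
rewrite (IH _ (upd w x 0) _ (fmeas_upd _ _ mF))//; last first.
  by move=> z zs; rewrite /upd; case: eqP => // zx; rewrite w0// inE negb_or zs andbT; apply/eqP.
apply: eq_iint => phi; congr F; apply/funext => z; rewrite /upd !fctE.
by case: eqP => // ->.
Qed.

End iterated_integral.

(** * Gaussian integrals and product integrands *)

Section gaussian.
Variable R : realType.
Notation mu := (@lebesgue_measure R).

Lemma measurable_expquad (k s : R) :
  measurable_fun setT (fun t : R => expR (- k * t ^+ 2 + s * t)).
Proof.
apply: measurableT_comp => //; apply: measurable_funD; apply: measurable_funM => //.
Qed.

Lemma integral_expquad (k s : R) : 0 < k ->
  (\int[mu]_t (expR (- k * t ^+ 2 + s * t))%:E =
   (Num.sqrt (pi / k) * expR (s ^+ 2 / (4 * k)))%:E)%E.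
Proof.
move=> k0; pose m := s / (2 * k); pose sg := Num.sqrt (2 * k)^-1.
have k2 : 0 < (2 * k)^-1 by rewrite invr_gt0 mulr_gt0.
have sg2 : sg ^+ 2 = (2 * k)^-1 by rewrite /sg sqr_sqrtr// ltW.
have sg0 : sg != 0 by rewrite gt_eqF// sqrtr_gt0.
pose c := Num.sqrt (pi / k) * expR (s ^+ 2 / (4 * k)).
have c0 : 0 <= c by rewrite mulr_ge0// ?sqrtr_ge0// expR_ge0.
have E t : (expR (- k * t ^+ 2 + s * t))%:E = (c%:E * (normal_pdf m sg t)%:E)%E.
  rewrite normal_pdfE// /normal_peak /normal_fun sg2 -EFinM; congr EFin.
  have -> : (2 * k)^-1 * pi *+ 2 = pi / k.
    by rewrite invfM -mulr_natr; field; rewrite gt_eqF.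
  rewrite /c mulrACA [_ * (Num.sqrt _)^-1]mulfV ?gt_eqF ?sqrtr_gt0 ?divr_gt0 ?pi_gt0//.
  rewrite mul1r -expRD; congr expR; rewrite /m -mulr_natr.
  by field; rewrite gt_eqF.
under eq_integral do rewrite E.
rewrite ge0_integralZl_EFin ?integral_normal_pdf ?mule1//.
- by move=> t _; rewrite lee_fin normal_pdf_ge0.
- by apply/measurable_EFinP; exact: measurable_normal_pdf.
Qed.

End gaussian.

Section product.
Variables (R : realType) (d : nat).
Notation mu := (@lebesgue_measure R).
Notation field := (field R d).
Implicit Types (f g : field -> R).

Definition rmeas f := forall d1 (T1 : measurableType d1) (u : T1 -> field),
  (forall z, measurable_fun setT (fun t => u t z)) ->
  measurable_fun setT (fun t => f (u t)).

Lemma rmeas_fmeas f : rmeas f -> fmeas (fun phi => (f phi)%:E).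
Proof. by move=> mf d1 T1 u /mf; move/measurable_EFinP. Qed.

Lemma rmeas_cst (c : R) : rmeas (fun=> c).
Proof. by move=> d1 T1 u mu_; exact: measurable_cst. Qed.

Lemma rmeas_coord (k : R -> R) z : measurable_fun setT k ->
  rmeas (fun phi => k (phi z)).
Proof. by move=> mk d1 T1 u mu_; exact: measurableT_comp. Qed.

Lemma rmeasD f g : rmeas f -> rmeas g -> rmeas (fun phi => f phi + g phi).
Proof.
by move=> mf mg d1 T1 u mu_; apply: measurable_funD; [exact: mf|exact: mg].
Qed.

Lemma rmeasM f g : rmeas f -> rmeas g -> rmeas (fun phi => f phi * g phi).
Proof.
by move=> mf mg d1 T1 u mu_; apply: measurable_funM; [exact: mf|exact: mg].
Qed.

Lemma rmeas_sum (I : Type) (r : seq I) (f : I -> field -> R) :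
  (forall i, rmeas (f i)) -> rmeas (fun phi => \sum_(i <- r) f i phi).
Proof.
by move=> mf d1 T1 u mu_; apply: measurable_sum => i; exact: mf.
Qed.

Lemma rmeas_prod (I : Type) (r : seq I) (f : I -> field -> R) :
  (forall i, rmeas (f i)) -> rmeas (fun phi => \prod_(i <- r) f i phi).
Proof.
move=> mf; elim: r => [|i r IH].
  under eq_fun do rewrite big_nil.
  exact: (rmeas_cst 1).
under eq_fun do rewrite big_cons.
exact: (rmeasM (mf i) IH).
Qed.

Lemma rmeas_expR f : rmeas f -> rmeas (fun phi => expR (f phi)).
Proof. by move=> mf d1 T1 u mu_; apply: measurableT_comp => //; exact: mf. Qed.

Lemma iint_prod (s : seq (site d)) (k : site d -> R -> R) (c : site d -> R) :
  uniq s -> (forall x t, 0 <= k x t) ->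
  (forall x, measurable_fun setT (k x)) ->
  (forall x, x \in s -> \int[mu]_t (k x t)%:E = (c x)%:E)%E ->
  (iint s (fun phi => (\prod_(x <- s) k x (phi x))%:E) =
    (\prod_(x <- s) c x)%:E)%E.
Proof.
move=> + k0 mk; elim: s => [|x s IH] /=; first by rewrite !big_nil.
move=> /andP[xs us] kc.
have kc' y : y \in s -> (\int[mu]_t (k y t)%:E = (c y)%:E)%E.
  by move=> ys; apply: kc; rewrite inE ys orbT.
transitivity (\int[mu]_t ((\prod_(y <- s) c y)%:E * (k x t)%:E))%E.
  apply: eq_integral => t _; rewrite muleC -(IH us kc') -iintZl//; last 2 first.
  - by move=> phi; rewrite lee_fin prodr_ge0.
  - exact: (rmeas_fmeas (rmeas_prod s (fun y => rmeas_coord y (mk y)))).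
  apply: eq_iint => phi; rewrite -EFinM big_cons /upd eqxx; congr (_ * _)%:E.
  apply: eq_big_seq => y ys; case: eqP => // yx.
  by move: xs; rewrite -yx ys.
rewrite ge0_integralZl_EFin//; last 3 first.
- by move=> t _; rewrite lee_fin.
- by apply/measurable_EFinP; exact: mk.
- rewrite -lee_fin -(IH us kc'); apply: iint_ge0 => phi.
  by rewrite lee_fin prodr_ge0.
by rewrite big_cons kc ?mem_head// -EFinM mulrC.
Qed.

Lemma iint_sum (I : Type) (r : seq I) (s : seq (site d)) (F : I -> field -> \bar R) :
  (forall i phi, 0 <= F i phi)%E -> (forall i, fmeas (F i)) ->
  (iint s (fun phi => \sum_(i <- r) F i phi) = \sum_(i <- r) iint s (F i))%E.
Proof.
move=> F0 mF.
have mS r' : fmeas (fun phi => \sum_(i <- r') F i phi)%E.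
  move=> d1 T1 u mu_; apply: emeasurable_sum => i; exact: mF.
elim: r => [|i r IH].
  rewrite big_nil; under eq_iint do rewrite big_nil.
  elim: s => //= x s ->; exact: integral0.
rewrite big_cons -IH -iintD//.
  by apply: eq_iint => phi; rewrite big_cons.
by move=> phi; apply: sume_ge0.
Qed.

End product.

(** * Jensen under product Gaussians, and Gaussian mixtures *)

Section jensen.
Variables (R : realType) (d : nat).
Notation mu := (@lebesgue_measure R).
Notation field := (field R d).
Variable L : seq (site d).
Hypothesis uL : uniq L.

(** Total mass of [expR (- t^2 + s t)], up to normalization the Gaussian of mean [s / 2] and
    variance 1/2. *)
Definition gauss_mass (s : R) : R := Num.sqrt pi * expR (s ^+ 2 / 4).

Lemma gauss_mass_gt0 s : 0 < gauss_mass s.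
Proof. by rewrite mulr_gt0 ?expR_gt0// sqrtr_gt0 pi_gt0. Qed.

Lemma integral_gauss_mass s :
  (\int[mu]_t (expR (- t ^+ 2 + s * t))%:E = (gauss_mass s)%:E)%E.
Proof.
have := @integral_expquad R 1 s ltr01; rewrite divr1 mulr1 => <-.
by apply: eq_integral => t _; rewrite mulN1r.
Qed.

Lemma measurable_tilt (s : R) :
  measurable_fun setT (fun t : R => expR (- t ^+ 2 + s * t)).
Proof.
by have := measurable_expquad 1 s; under eq_fun do rewrite mulN1r.
Qed.

Definition tilt (s phi : field) : R :=
  \sum_(x <- L) (- phi x ^+ 2 + s x * phi x).

Lemma rmeas_tilt s : rmeas (tilt s).
Proof.
apply: (@rmeas_sum _ _ _ _ (fun x phi => - phi x ^+ 2 + s x * phi x)) => x.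
apply: (@rmeas_coord _ _ (fun t => - t ^+ 2 + s x * t)).
apply: measurable_funD; last exact: measurable_funM.
exact: measurableT_comp.
Qed.

Lemma expR_tilt s phi :
  expR (tilt s phi) = \prod_(x <- L) expR (- phi x ^+ 2 + s x * phi x).
Proof. by rewrite /tilt expR_sum. Qed.

Let PK (s : field) : R := \prod_(x <- L) gauss_mass (s x).

Let PK_gt0 s : 0 < PK s.
Proof. by rewrite prodr_gt0// => x _; exact: gauss_mass_gt0. Qed.

Lemma iint_tilt s : (iint L (fun phi => (expR (tilt s phi))%:E) = (PK s)%:E)%E.
Proof.
rewrite -(@iint_prod _ _ L (fun x t => expR (- t ^+ 2 + s x * t)))//.
- by apply: eq_iint => phi; rewrite expR_tilt.
- by move=> x; exact: measurable_tilt.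
- by move=> x _; exact: integral_gauss_mass.
Qed.

Lemma iint_tilt_site s y (g : R -> R) (G : R) : y \in L ->
  (forall t, 0 <= g t) -> measurable_fun setT g ->
  (\int[mu]_t (g t * expR (- t ^+ 2 + s y * t))%:E = G%:E)%E ->
  (iint L (fun phi => (g (phi y) * expR (tilt s phi))%:E) =
    (G / gauss_mass (s y) * PK s)%:E)%E.
Proof.
move=> yL g0 mg gG.
pose k x t := (if x == y then g t else 1) * expR (- t ^+ 2 + s x * t).
pose c x := if x == y then G else gauss_mass (s x).
transitivity (iint L (fun phi => (\prod_(x <- L) k x (phi x))%:E)).
  apply: eq_iint => phi; rewrite big_split /= expR_tilt; congr (_ * _)%:E.
  rewrite (bigD1_seq y)//= eqxx big1 ?mulr1//.
  by move=> x /negPf ->.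
rewrite (@iint_prod _ _ L k c)//.
- rewrite /PK !(bigD1_seq y)//= {1}/c eqxx.
  rewrite mulrA divfK ?gt_eqF ?gauss_mass_gt0//; congr (_ * _)%:E.
  by apply: eq_bigr => x; rewrite /c => /negPf ->.
- by move=> x t; rewrite /k; case: ifP => _; rewrite mulr_ge0// expR_ge0.
- move=> x; rewrite /k; case: (x == y).
    by apply: measurable_funM => //; exact: measurable_tilt.
  by under eq_fun do rewrite mul1r; exact: measurable_tilt.
- move=> x xL; rewrite /k /c; case: eqP => [->//|_].
  by under eq_integral do rewrite mul1r; exact: integral_gauss_mass.
Qed.

Variables (f th rho : site d -> R -> R) (F Th Rho : site d -> R -> R).
Hypothesis f0 : forall x t, 0 <= f x t.
Hypothesis th0 : forall x t, 0 <= th x t.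
Hypothesis rho0 : forall x t, 0 <= rho x t.
Hypothesis mf : forall x, measurable_fun setT (f x).
Hypothesis mth : forall x, measurable_fun setT (th x).
Hypothesis mrho : forall x, measurable_fun setT (rho x).
Hypothesis fF : forall x s, x \in L ->
  (\int[mu]_t (f x t * expR (- t ^+ 2 + s * t))%:E = (F x s)%:E)%E.
Hypothesis thF : forall x s, x \in L ->
  (\int[mu]_t (th x t * expR (- t ^+ 2 + s * t))%:E = (Th x s)%:E)%E.
Hypothesis rhoF : forall x s, x \in L ->
  (\int[mu]_t (rho x t * expR (- t ^+ 2 + s * t))%:E = (Rho x s)%:E)%E.
Hypothesis fthrho : forall x s, x \in L ->
  gauss_mass s * expR ((Th x s - Rho x s) / gauss_mass s) <= F x s.

Lemma iint_tilt_sum s (g : site d -> R -> R) (G : site d -> R -> R) :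
  (forall x t, 0 <= g x t) -> (forall x, measurable_fun setT (g x)) ->
  (forall x s, x \in L ->
    (\int[mu]_t (g x t * expR (- t ^+ 2 + s * t))%:E = (G x s)%:E)%E) ->
  (iint L (fun phi => ((\sum_(x <- L) g x (phi x)) * expR (tilt s phi))%:E) =
    (\sum_(x <- L) G x (s x) / gauss_mass (s x) * PK s)%:E)%E.
Proof.
move=> g0 mg gG.
transitivity (iint L (fun phi => \sum_(x <- L)
    (g x (phi x) * expR (tilt s phi))%:E)%E).
  by apply: eq_iint => phi; rewrite mulr_suml sumEFin.
rewrite (@iint_sum _ _ _ L L (fun x phi => (g x (phi x) * expR (tilt s phi))%:E)).
- rewrite -sumEFin; apply: eq_big_seq => x xL.
  by rewrite (@iint_tilt_site s x (g x) (G x (s x)))// gG.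
- by move=> x phi; rewrite lee_fin mulr_ge0// expR_ge0.
- move=> x; exact: (rmeas_fmeas (rmeasM (rmeas_coord x (mg x))
    (rmeas_expR (rmeas_tilt s)))).
Qed.

(** If [Y] is the average of the sum of [th - rho] under a tilted product, then the average of the
    product of the [f] is at least [e^Y], and [e^(Y - T) >= 1 + Y - T]. Moving the negative terms
    across yields [obs_lo] and [obs_hi], both nonnegative, so that all integrals make sense before
    any finiteness is known. *)
Definition obs_lo (phi : field) : R := 1 + \sum_(x <- L) th x (phi x).
Definition obs_hi (T : R) (phi : field) : R := expR (- T) * (\prod_(x <- L) f x (phi x)) +
  (\sum_(x <- L) rho x (phi x) + T).

Lemma obs_lo_ge0 phi : 0 <= obs_lo phi.
Proof. by rewrite addr_ge0// sumr_ge0. Qed.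

Lemma obs_hi_ge0 T phi : 0 <= T -> 0 <= obs_hi T phi.
Proof.
by move=> T0; rewrite addr_ge0 ?mulr_ge0 ?expR_ge0 ?prodr_ge0 ?addr_ge0// sumr_ge0.
Qed.

Let msum (g : site d -> R -> R) : (forall x, measurable_fun setT (g x)) ->
  rmeas (fun phi : field => \sum_(x <- L) g x (phi x)).
Proof.
move=> mg; exact: (rmeas_sum L (fun x => rmeas_coord x (mg x))).
Qed.

Let mprod : rmeas (fun phi : field => \prod_(x <- L) f x (phi x)).
Proof. exact: (rmeas_prod L (fun x => rmeas_coord x (mf x))). Qed.

Lemma rmeas_obs_lo : rmeas obs_lo.
Proof. exact: (rmeasD (rmeas_cst 1) (msum mth)). Qed.

Lemma rmeas_obs_hi T : rmeas (obs_hi T).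
Proof.
exact: (rmeasD (rmeasM (rmeas_cst _) mprod) (rmeasD (msum mrho) (rmeas_cst T))).
Qed.

Lemma iint_tilt_le s T : 0 <= T ->
  (iint L (fun phi => (obs_lo phi * expR (tilt s phi))%:E) <=
   iint L (fun phi => (obs_hi T phi * expR (tilt s phi))%:E))%E.
Proof.
move=> T0.
have mt := rmeas_expR (rmeas_tilt s).
have e0 phi : 0 <= expR (tilt s phi) by exact: expR_ge0.
have -> : iint L (fun phi => (obs_lo phi * expR (tilt s phi))%:E) =
    (PK s + \sum_(x <- L) Th x (s x) / gauss_mass (s x) * PK s)%:E.
  rewrite EFinD -iint_tilt -(iint_tilt_sum s th0 mth thF) -iintD//.
  - by apply: eq_iint => phi; rewrite mulrDl mul1r EFinD.
  - by move=> phi; rewrite lee_fin mulr_ge0// sumr_ge0.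
  - exact: rmeas_fmeas.
  - exact: (rmeas_fmeas (rmeasM (msum mth) mt)).
have -> : iint L (fun phi => (obs_hi T phi * expR (tilt s phi))%:E) =
    (expR (- T) * (\prod_(x <- L) F x (s x)) +
     (\sum_(x <- L) Rho x (s x) / gauss_mass (s x) * PK s + T * PK s))%:E.
  have fint : iint L (fun phi => ((\prod_(x <- L) f x (phi x)) * expR (tilt s phi))%:E) =
      (\prod_(x <- L) F x (s x))%:E.
    rewrite -(@iint_prod _ _ L (fun x t => f x t * expR (- t ^+ 2 + s x * t)))//.
    - by apply: eq_iint => phi; rewrite big_split /= expR_tilt.
    - by move=> x t; rewrite mulr_ge0 ?expR_ge0.
    - by move=> x; apply: measurable_funM => //; exact: measurable_tilt.
    - by move=> x xL; exact: fF.
  rewrite !EFinD !EFinM -fint -iint_tilt -(iint_tilt_sum s rho0 mrho rhoF).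
  rewrite -iintZl ?expR_ge0//; last 2 first.
  - by move=> phi; rewrite lee_fin mulr_ge0 ?prodr_ge0.
  - exact: (rmeas_fmeas (rmeasM mprod mt)).
  rewrite -iintZl//; last exact: rmeas_fmeas.
  rewrite -iintD//; last 4 first.
  - by move=> phi; rewrite lee_fin mulr_ge0// sumr_ge0.
  - by move=> phi; rewrite -EFinM lee_fin mulr_ge0.
  - exact: (rmeas_fmeas (rmeasM (msum mrho) mt)).
  - exact: (rmeas_fmeas (rmeasM (rmeas_cst T) mt)).
  rewrite -iintD//; last 4 first.
  - by move=> phi; rewrite -EFinM lee_fin mulr_ge0 ?expR_ge0// mulr_ge0 ?prodr_ge0.
  - by move=> phi; rewrite -EFinM -EFinD lee_fin addr_ge0// mulr_ge0// sumr_ge0.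
  - exact: (rmeas_fmeas (rmeasM (rmeas_cst _) (rmeasM mprod mt))).
  - exact: (rmeas_fmeas (rmeasD (rmeasM (msum mrho) mt) (rmeasM (rmeas_cst T) mt))).
  apply: eq_iint => phi; rewrite -!EFinM -!EFinD /obs_hi; congr EFin; ring.
rewrite lee_fin.
pose Y := \sum_(x <- L) (Th x (s x) - Rho x (s x)) / gauss_mass (s x).
have FY : PK s * expR Y <= \prod_(x <- L) F x (s x).
  rewrite expR_sum -big_split /=.
  rewrite [leLHS]big_seq [leRHS]big_seq ler_prod// => x xL.
  by rewrite fthrho// andbT mulr_ge0 ?expR_ge0// ltW// gauss_mass_gt0.
have {FY} : PK s * (1 + (Y - T)) <= expR (- T) * \prod_(x <- L) F x (s x).
  apply: (@le_trans _ _ (expR (- T) * (PK s * expR Y))); last first.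
    by rewrite ler_wpM2l// expR_ge0.
  rewrite mulrCA -expRD ler_wpM2l ?(ltW (PK_gt0 s))//.
  by rewrite [- T + Y]addrC expR_ge1Dx.
have -> : Y = \sum_(x <- L) Th x (s x) / gauss_mass (s x) -
    \sum_(x <- L) Rho x (s x) / gauss_mass (s x).
  by rewrite -sumrB; apply: eq_bigr => x _; rewrite mulrBl.
rewrite -!mulr_suml; lra.
Qed.

End jensen.

(** * Mixing product Gaussians over their means *)

Section mixture.
Variables (R : realType) (d : nat).
Notation mu := (@lebesgue_measure R).
Notation field := (field R d).
Variable L : seq (site d).
Hypothesis uL : uniq L.
Variables (A B : field -> R).
Hypothesis A0 : forall phi, 0 <= A phi.
Hypothesis B0 : forall phi, 0 <= B phi.
Hypothesis mA : rmeas A.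
Hypothesis mB : rmeas B.
Hypothesis AB : forall s : field,
  (iint L (fun phi => (A phi * expR (tilt L s phi))%:E) <=
   iint L (fun phi => (B phi * expR (tilt L s phi))%:E))%E.

Definition edge_sum (E : seq (site d * site d)) (phi : field) : R :=
  \sum_(e <- E) (phi e.1 + phi e.2) ^+ 2.

Lemma rmeas_edge_sum E : rmeas (edge_sum E).
Proof.
apply: (@rmeas_sum _ _ _ _ (fun e phi => (phi e.1 + phi e.2) ^+ 2)) => e.
move=> d1 T1 u mu_; apply: measurable_funX; exact: measurable_funD.
Qed.

(** A linear term in [phi e.1 + phi e.2] only shifts the tilts at the two ends; an end outside [L]
    contributes zero to both sides. *)
Lemma tilt_shift (s phi : field) (e : site d * site d) (h : R) :
  (forall z, z \notin L -> phi z = 0) ->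
  tilt L (fun x => s x + h * ((x == e.1)%:R + (x == e.2)%:R)) phi =
  tilt L s phi + h * (phi e.1 + phi e.2).
Proof.
move=> phi0.
have D z : \sum_(x <- L) (x == z)%:R * phi x = phi z.
  have [zL|zL] := boolP (z \in L).
    rewrite (bigD1_seq z)//= eqxx mul1r big1 ?addr0//.
    by move=> x /negPf ->; rewrite mul0r.
  rewrite phi0// big_seq big1// => x xL; case: eqP => [xz|]; rewrite ?mul0r//.
  by rewrite xz (negPf zL) in xL.
rewrite -[in RHS](D e.1) -[in RHS](D e.2) -big_split mulr_sumr -big_split.
by apply: eq_bigr => x _ /=; ring.
Qed.

(* Hubbard--Stratonovich: [expR (c z^2)] is a mixture of exponentials [expR (h z)],
   so an inequality valid for all product Gaussians survives the couplings. *)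
Lemma iint_mixture_le (c : R) E (s : field) : 0 < c ->
  (iint L (fun phi => (A phi * expR (tilt L s phi + c * edge_sum E phi))%:E) <=
   iint L (fun phi => (B phi * expR (tilt L s phi + c * edge_sum E phi))%:E))%E.
Proof.
move=> c0; elim: E s => [|e E IH] s.
  rewrite /edge_sum; under eq_iint do rewrite big_nil mulr0 addr0.
  by under [leRHS]eq_iint do rewrite big_nil mulr0 addr0.
(* Integrating [expR (- k h^2 + z h)] over [h] gives a multiple of [expR (z^2 / (4 k))]; this [k]
   makes the exponent [c z^2], and [w] normalizes. *)
pose k := (4 * c)^-1.
have k0 : 0 < k by rewrite invr_gt0 mulr_gt0.
pose w := (Num.sqrt (pi / k))^-1.
have w0 : 0 < w by rewrite invr_gt0 sqrtr_gt0 divr_gt0// pi_gt0.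
pose G (D : field -> R) (h : measurableTypeR R) (phi : field) : \bar R :=
  (D phi * expR (tilt L s phi + c * edge_sum E phi) *
    (w * expR (- k * h ^+ 2 + (phi e.1 + phi e.2) * h)))%:E.
have G0 D h phi : (forall phi, 0 <= D phi) -> (0 <= G D h phi)%E.
  by move=> D0; rewrite lee_fin !mulr_ge0 ?expR_ge0 ?(ltW w0).
have mG D : rmeas D -> jmeas (G D).
  move=> mD d1 T1 v u mv mu_; apply/measurable_EFinP; apply: measurable_funM.
    exact: (rmeasM mD (rmeas_expR (rmeasD (rmeas_tilt L s)
      (rmeasM (rmeas_cst c) (rmeas_edge_sum E)))) mu_).
  apply: measurable_funM => //; apply: measurableT_comp => //.
  apply: measurable_funD; apply: measurable_funM => //.
    exact: measurable_funX.
  exact: measurable_funD.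
have step D : (forall phi, 0 <= D phi) -> rmeas D ->
    iint L (fun phi => (D phi * expR (tilt L s phi + c * edge_sum (e :: E) phi))%:E) =
    (\int[mu]_h iint L (G D h))%E.
  move=> D0 mD; rewrite -iint_integral//; last 2 first.
  - by move=> h phi; exact: G0.
  - exact: mG.
  apply: eq_iint => phi; rewrite /G.
  under eq_integral do rewrite mulrA EFinM.
  rewrite ge0_integralZl_EFin//; last 2 first.
  - by apply/measurable_EFinP; exact: measurable_expquad.
  - by rewrite !mulr_ge0 ?expR_ge0 ?(ltW w0).
  rewrite integral_expquad// -EFinM; congr EFin.
  rewrite -!mulrA [w * _]mulrA mulVf ?gt_eqF ?sqrtr_gt0 ?divr_gt0 ?pi_gt0//.
  rewrite mul1r -expRD; congr (_ * expR _).
  rewrite /edge_sum big_cons mulrDr -addrA; congr (_ + _); rewrite addrC.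
  have c1 : c != 0 by rewrite gt_eqF.
  congr (_ + _); rewrite /k; field; exact: c1.
have stepI D h : (forall phi, 0 <= D phi) -> rmeas D -> iint L (G D h) =
    ((w * expR (- k * h ^+ 2))%:E * iint L (fun phi => (D phi * expR
     (tilt L (fun x => (s x + h * ((x == e.1)%:R + (x == e.2)%:R))%R) phi
       + c * edge_sum E phi))%:E))%E.
  move=> D0 mD; rewrite -iintZl; last 3 first.
  - by rewrite mulr_ge0 ?expR_ge0 ?(ltW w0).
  - by move=> phi; rewrite lee_fin mulr_ge0// expR_ge0.
  - exact: (rmeas_fmeas (rmeasM mD (rmeas_expR (rmeasD (rmeas_tilt L _)
      (rmeasM (rmeas_cst c) (rmeas_edge_sum E)))))).
  apply: eq_iint_supp => phi phi0; rewrite /G tilt_shift// -EFinM; congr EFin.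
  by rewrite [(_ + _) * h]mulrC !expRD; ring.
rewrite !step//; apply: ge0_le_integral => //.
- by move=> h _; apply: iint_ge0 => phi; exact: G0.
- by apply: measurable_iint; [move=> h phi; exact: G0|exact: mG].
- by apply: measurable_iint; [move=> h phi; exact: G0|exact: mG].
- move=> h _; rewrite !stepI// lee_pmul2l ?fin_numE// lte_fin.
  by rewrite mulr_gt0 ?expR_gt0.
Qed.

End mixture.

(** * The lattice and the Dirichlet form *)

Section lattice.
Variables (R : realType) (d : nat).
Notation site := (site d).
Implicit Types (x y z : site) (p : 'I_d * bool).

Definition nbr x p : site :=
  [ffun j => x j + (if j == p.1 then (if p.2 then 1 else -1) else 0)].

Lemma nbr_inj x : injective (nbr x).
Proof.
move=> [i b] [j c] /ffunP E; have := E i; rewrite !ffunE /= eqxx.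
case: eqP => [->|_]; last by case: b {E} => /addrI.
by case: b {E}; case: c => // /addrI.
Qed.

Lemma mem_box m x : (x \in box d m) = [forall i, `|x i| <= m%:Z].
Proof.
apply/mapP/forallP => [[f _ ->] i|H].
  by rewrite ffunE ler_norml; move: (ltn_ord (f i)); move: (nat_of_ord (f i)) => k kb; lia.
exists [ffun i => inord `|(x i + m%:Z)%R|%N]; first by rewrite mem_enum inE.
apply/ffunP => i; have := H i; rewrite ler_norml => /andP[].
rewrite !ffunE; move: (x i) => v v1 v2.
have v3 : v + m%:Z = `|(v + m%:Z)%R|%N by rewrite gez0_abs//; lia.
by rewrite inordK; [rewrite -v3; lia|rewrite -ltz_nat -v3; lia].
Qed.

Lemma uniq_box m : uniq (box d m).
Proof.
rewrite map_inj_uniq ?enum_uniq// => f g /ffunP E; apply/ffunP => i.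
by have := E i; rewrite !ffunE => /addIr [] /val_inj.
Qed.

Lemma size_box m : size (box d m) = (m.*2.+1 ^ d)%N.
Proof. by rewrite size_map -cardE cardsT card_ffun !card_ord. Qed.

Definition nbrs x : seq site := [seq nbr x p | p <- enum {: 'I_d * bool}].

Lemma uniq_nbrs x : uniq (nbrs x).
Proof. by rewrite map_inj_uniq ?enum_uniq//; exact: nbr_inj. Qed.

Lemma dist2C x y : dist2 x y = dist2 y x.
Proof. by apply: eq_bigr => i _; rewrite -sqrrN opprB. Qed.

(** A sum of squares of integers equals 1 only if exactly one term is nonzero and it is 1, which
    leaves the [2 d] signed unit vectors. *)
Lemma mem_nbrs x y : (y \in nbrs x) = (dist2 x y == 1).
Proof.
apply/mapP/eqP => [[[i b] _ ->]|].
  rewrite /dist2 (bigD1 i)//= big1 => [|j /negPf ji].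
    by rewrite ffunE eqxx addr0; case: b => /=; lia.
  by rewrite ffunE ji addr0 subrr.
move=> xy; have [i xyi] : exists i, x i != y i.
  apply/existsP; apply: contraPT xy; rewrite negb_exists => /forallP xy.
  rewrite /dist2 big1// => i _.
  by have := xy i; rewrite negbK => /eqP ->; rewrite subrr.
have sq0 j : 0 <= (x j - y j) ^+ 2 by rewrite sqr_ge0.
move: xy; rewrite /dist2 (bigD1 i)//= => xy.
have s0 : 0 <= \sum_(j < d | j != i) (x j - y j) ^+ 2 by exact: sumr_ge0.
have xyi1 : 1 <= (x i - y i) ^+ 2.
  by rewrite -gtz0_ge1 lt_neqAle sq0 andbT eq_sym sqrf_eq0 subr_eq0.
have {}s0 : \sum_(j < d | j != i) (x j - y j) ^+ 2 = 0.
  move: xy s0 xyi1.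
  move: (\sum_(j < d | j != i) _) ((x i - y i) ^+ 2) => S A; lia.
move/eqP: s0; rewrite psumr_eq0// => /allP s0.
have {}xyi : (x i - y i) ^+ 2 = 1.
  move: xy; rewrite big1 ?addr0// => j ji.
  by have := s0 j (mem_index_enum _); rewrite ji => /eqP.
exists (i, y i == x i + 1); first by rewrite mem_enum.
apply/ffunP => j; rewrite ffunE /=; case: eqP => [->|/eqP ji].
  have /eqP := xyi; rewrite sqrf_eq1 => /orP[] /eqP E.
  - by rewrite (_ : _ == _ = false); lia.
  - by rewrite (_ : _ == _ = true); lia.
have := s0 j (mem_index_enum _); rewrite ji /= sqrf_eq0 subr_eq0 => /eqP ->.
by rewrite addr0.
Qed.

Lemma nbr_sym x p : exists q, nbr (nbr x p) q = x.
Proof.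
have : x \in nbrs (nbr x p).
  by rewrite mem_nbrs dist2C -mem_nbrs map_f// mem_enum.
by move=> /mapP[q _ E]; exists q; rewrite -E.
Qed.

Lemma norm_nbr_le x p i : `|nbr x p i| <= `|x i| + 1.
Proof.
rewrite ffunE; apply: (le_trans (ler_normD _ _)); rewrite lerD2l.
by case: ifP => _; [case: p.2|]; rewrite ?normrN ?normr1 ?normr0.
Qed.

Variable N : nat.

Lemma uniq_Lam : uniq (Lam d N). Proof. exact: uniq_box. Qed.

Lemma uniq_LamBd : uniq (LamBd d N).
Proof. by rewrite filter_uniq// uniq_box. Qed.

Lemma Lam_LamBd x : x \in Lam d N -> x \in LamBd d N.
Proof.
move=> xL; rewrite mem_filter xL /=; move: xL; rewrite !mem_box.
by move=> /forallP H; apply/forallP => i; apply: (le_trans (H i)); lia.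
Qed.

Lemma nbr_LamBd x p : x \in Lam d N -> nbr x p \in LamBd d N.
Proof.
move=> xL; rewrite mem_filter; apply/andP; split.
  apply/orP; right; apply/hasP; exists x => //.
  by rewrite dist2C -mem_nbrs map_f// mem_enum.
move: xL; rewrite !mem_box => /forallP H; apply/forallP => i.
by apply: (le_trans (norm_nbr_le _ _ _)); have := H i; lia.
Qed.

(** [Ham] runs over pairs inside [LamBd], [Qf] over all [2 d] directions; the condition on [F]
    covers the directions that leave [LamBd]. *)
Lemma sum_nbrs x (F : site -> R) :
  (forall p, nbr x p \notin LamBd d N -> F (nbr x p) = 0) ->
  \sum_(y <- LamBd d N | dist2 x y == 1) F y = \sum_p F (nbr x p).
Proof.
move=> F0.
transitivity (\sum_(y <- nbrs x | y \in LamBd d N) F y).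
  rewrite -big_filter -[RHS]big_filter; apply: perm_big; apply: uniq_perm.
  - by rewrite filter_uniq// uniq_LamBd.
  - by rewrite filter_uniq// uniq_nbrs.
  - by move=> y; rewrite !mem_filter mem_nbrs andbC.
rewrite big_mkcond big_map big_enum /=; apply: eq_bigr => p _.
by case: ifPn => // /F0 ->.
Qed.

Definition supp (phi : field R d) := forall z, z \notin Lam d N -> phi z = 0.

Lemma supp_nbr (phi : field R d) x p : supp phi -> x \in LamBd d N ->
  nbr x p \notin LamBd d N -> phi x = phi (nbr x p).
Proof.
move=> s0 xB nB; rewrite !s0//; apply: contra nB.
  exact: Lam_LamBd.
exact: nbr_LamBd.
Qed.

Lemma sum_LamBd (F : site -> R) : (forall z, z \notin Lam d N -> F z = 0) ->
  \sum_(x <- LamBd d N) F x = \sum_(x <- Lam d N) F x.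
Proof.
move=> F0; rewrite (bigID (mem (Lam d N)))/= [X in _ + X]big1 ?addr0//.
rewrite -big_filter; apply: perm_big; apply: uniq_perm.
- by rewrite filter_uniq// uniq_LamBd.
- exact: uniq_Lam.
- move=> x; rewrite mem_filter; apply/andP/idP => [[]//|xL].
  by split => //; exact: Lam_LamBd.
Qed.

(* [Qf] is the operator [I - P], with [P] the transition operator of simple
   random walk; [2 Ham phi] is the quadratic form of [Qf] on fields that vanish
   outside the box. *)
Definition Qf (w : field R d) x : R := w x - (2 * d%:R)^-1 * \sum_p w (nbr x p).

Definition bform (phi w : field R d) : R :=
  (8 * d%:R)^-1 * \sum_(x <- LamBd d N) \sum_(y <- LamBd d N | dist2 x y == 1)
     (phi x - phi y) * (w x - w y).

Lemma Ham_bform phi : Ham N phi = bform phi phi.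
Proof. by []. Qed.

Lemma HamD phi w : Ham N (phi + w) = Ham N phi + 2 * bform phi w + Ham N w.
Proof.
rewrite /Ham /bform -mulrCA -!mulrDr; congr (_ * _).
rewrite mulr_sumr -!big_split; apply: eq_bigr => x _ /=.
rewrite mulr_sumr -!big_split; apply: eq_bigr => y _ /=.
by rewrite !fctE; ring.
Qed.

Hypothesis d0 : (0 < d)%N.
Let dR : d%:R != 0 :> R. Proof. by rewrite pnatr_eq0 -lt0n. Qed.

Lemma sum_pairsC (F : site -> site -> R) :
  \sum_(x <- LamBd d N) \sum_(y <- LamBd d N | dist2 x y == 1) F x y =
  \sum_(x <- LamBd d N) \sum_(y <- LamBd d N | dist2 x y == 1) F y x.
Proof.
rewrite (exchange_big_dep xpredT)//=; apply: eq_bigr => x _.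
by apply: eq_bigl => y; rewrite dist2C.
Qed.

Lemma sum_dir (c : R) : \sum_(p : 'I_d * bool) c = 2 * d%:R * c.
Proof.
by rewrite sumr_const card_prod card_ord card_bool -[LHS]mulr_natl natrM [d%:R * _]mulrC.
Qed.

(** Summation by parts: exchanging the ends of ordered pairs turns the product of increments into
    twice [phi x * (w x - w y)]. Then only box sites survive, and all their neighbours lie in
    [LamBd]. *)
Lemma bform_Qf phi w : supp phi ->
  2 * bform phi w = \sum_(x <- Lam d N) phi x * Qf w x.
Proof.
move=> s0; rewrite /bform.
have -> : \sum_(x <- LamBd d N) \sum_(y <- LamBd d N | dist2 x y == 1)
     (phi x - phi y) * (w x - w y) =
   2 * \sum_(x <- LamBd d N) \sum_(y <- LamBd d N | dist2 x y == 1)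
      phi x * (w x - w y).
  rewrite mulr2n mulrDl !mul1r [X in _ = _ + X]sum_pairsC -big_split.
  apply: eq_bigr => x _; rewrite -big_split; apply: eq_bigr => y _ /=; ring.
rewrite sum_LamBd; last by move=> z /s0 z0; rewrite big1// => y _; rewrite z0 mul0r.
rewrite !mulr_sumr big_seq [RHS]big_seq; apply: eq_bigr => x xL.
rewrite (@sum_nbrs x (fun y => phi x * (w x - w y))); last first.
  by move=> p; rewrite nbr_LamBd.
rewrite -mulr_sumr sumrB sum_dir /Qf.
by field.
Qed.

Lemma Ham_Qf phi : supp phi ->
  2 * Ham N phi = \sum_(x <- Lam d N) phi x * Qf phi x.
Proof. by move=> s0; rewrite Ham_bform bform_Qf. Qed.

Definition edges : seq (site * site) :=
  [seq e <- [seq (x, y) | x <- LamBd d N, y <- LamBd d N] | dist2 e.1 e.2 == 1].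

(** The identity [(p - q)^2 + (p + q)^2 = 2 p^2 + 2 q^2] on each pair. Every box site has [2 d]
    neighbours in [LamBd] and each bond is counted in both orders, so the diagonal is exactly
    [phi x^2], matching the exponent of [tilt]. *)
Lemma Ham_edges phi : supp phi ->
  Ham N phi = \sum_(x <- Lam d N) phi x ^+ 2 - (8 * d%:R)^-1 * edge_sum edges phi.
Proof.
move=> s0; apply/eqP; rewrite eq_sym subr_eq eq_sym; apply/eqP.
rewrite /edge_sum big_filter big_mkcond big_allpairs /=.
under eq_bigr do rewrite -big_mkcond /=.
rewrite /Ham -mulrDr -big_split /=.
transitivity ((8 * d%:R)^-1 * \sum_(x <- LamBd d N)
   \sum_(y <- LamBd d N | dist2 x y == 1) (2 * phi x ^+ 2 + 2 * phi y ^+ 2)).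
  congr (_ * _); apply: eq_bigr => x _; rewrite -big_split; apply: eq_bigr => y _ /=.
  ring.
have -> : \sum_(x <- LamBd d N)
   \sum_(y <- LamBd d N | dist2 x y == 1) (2 * phi x ^+ 2 + 2 * phi y ^+ 2) =
   4 * \sum_(x <- LamBd d N) \sum_(y <- LamBd d N | dist2 x y == 1) phi x ^+ 2.
  set S := (X in _ = 4 * X); have -> : 4 * S = 2 * S + 2 * S by ring.
  have SC : S = _ := sum_pairsC (fun x _ => phi x ^+ 2).
  rewrite {2}SC /S !mulr_sumr -big_split.
  by apply: eq_bigr => x _; rewrite !mulr_sumr -big_split.
rewrite sum_LamBd; last by move=> z /s0 z0; rewrite big1// => y _; rewrite z0 expr0n.
rewrite !mulr_sumr big_seq [RHS]big_seq; apply: eq_bigr => x xL.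
rewrite (@sum_nbrs x (fun y => phi x ^+ 2)); last first.
  by move=> p; rewrite nbr_LamBd.
rewrite sum_dir.
by field.
Qed.

Lemma Ham_ge0 (phi : field R d) : 0 <= Ham N phi.
Proof.
rewrite mulr_ge0 ?invr_ge0// sumr_ge0// => x _; rewrite sumr_ge0// => y _.
exact: sqr_ge0.
Qed.

End lattice.

(** * Transience of the three-dimensional orthant *)

Section flow.
Variable R : realType.
Implicit Types n i j k M : nat.

(** A share [1 / (n + 3)] of the mass of one vertex at level [n], the [(n + 1) (n + 2) / 2] vertices
    of that simplex carrying total mass 1. *)
Definition flow_coef n : R := 2 / ((n.+1)%:R * (n.+2)%:R * (n.+3)%:R).

Definition sum3 M (F : nat -> nat -> nat -> R) : R :=
  \sum_(i < M) \sum_(j < M) \sum_(k < M) F i j k.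

Lemma eq_sum3 M F G : (forall i j k, F i j k = G i j k) -> sum3 M F = sum3 M G.
Proof. by move=> FG; do 3 (apply: eq_bigr => ? _); exact: FG. Qed.

Lemma sum3D M F G : sum3 M (fun i j k => F i j k + G i j k) = sum3 M F + sum3 M G.
Proof.
rewrite /sum3 -big_split; apply: eq_bigr => i _; rewrite -big_split.
by apply: eq_bigr => j _; rewrite -big_split.
Qed.

Lemma sum3Z M c F : sum3 M (fun i j k => c * F i j k) = c * sum3 M F.
Proof.
rewrite /sum3 mulr_sumr; apply: eq_bigr => i _; rewrite mulr_sumr.
by apply: eq_bigr => j _; rewrite mulr_sumr.
Qed.

Lemma le_sum3 M F G : (forall i j k, F i j k <= G i j k) -> sum3 M F <= sum3 M G.
Proof. by move=> FG; do 3 (apply: ler_sum => ? _); exact: FG. Qed.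

Lemma sum_shift M (g : nat -> R) : g M = 0 ->
  \sum_(i < M) i.+1%:R * g i.+1 = \sum_(i < M) i%:R * g i.
Proof.
move=> gM; transitivity (\sum_(i < M.+1) i%:R * g i).
  by rewrite big_ord_recl /= mul0r add0r.
by rewrite big_ord_recr /= gM mulr0 addr0.
Qed.

Lemma flow_coefE n : n.+3%:R * flow_coef n = 2 / (n.+1%:R * n.+2%:R).
Proof.
have H m : m.+1%:R != 0 :> R by rewrite pnatr_eq0.
by rewrite /flow_coef mulrCA invfM [_^-1 * _^-1]mulrC mulVKf// H.
Qed.

Lemma flow_coefS n : n.+1%:R * flow_coef n = 2 / (n.+2%:R * n.+3%:R).
Proof.
have H m : m.+1%:R != 0 :> R by rewrite pnatr_eq0.
by rewrite /flow_coef mulrCA -mulrA invfM mulVKf// H.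
Qed.

Variables (M : nat) (psi : nat -> nat -> nat -> R).
Hypothesis M0 : (0 < M)%N.
Hypothesis psi0 : forall i j k, (M <= i)%N || (M <= j)%N || (M <= k)%N ->
  psi i j k = 0.

Let th (i n : nat) : R := i.+1%:R * flow_coef n.

(* The flow of Polya's urn: on the simplex [i + j + k = n] every vertex carries
   the same mass, and it sends the fraction [(i + 1) / (n + 3)] of it to
   [i + 1]. Its divergence is a unit source at the origin. *)
Lemma flow_divergence :
  sum3 M (fun i j k => th i (i + j + k) * (psi i j k - psi i.+1 j k) +
    (th j (i + j + k) * (psi i j k - psi i j.+1 k) +
     th k (i + j + k) * (psi i j k - psi i j k.+1))) = psi 0%N 0%N 0%N.
Proof.
(* Coefficient of the flow entering level [n]; nothing enters the origin. *)
pose c' n : R := if n is n'.+1 then flow_coef n' else 0.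
have X1 : sum3 M (fun i j k => th i (i + j + k) * psi i.+1 j k) =
    sum3 M (fun i j k => i%:R * (c' (i + j + k)%N * psi i j k)).
  rewrite /sum3 exchange_big [RHS]exchange_big; apply: eq_bigr => j _.
  rewrite exchange_big [RHS]exchange_big; apply: eq_bigr => k _ /=.
  rewrite -(@sum_shift M (fun i => c' (i + j + k)%N * psi i j k)).
    by apply: eq_bigr => i _; rewrite /th !addSn /= mulrA.
  by rewrite psi0 ?leqnn ?mulr0.
have X2 : sum3 M (fun i j k => th j (i + j + k) * psi i j.+1 k) =
    sum3 M (fun i j k => j%:R * (c' (i + j + k)%N * psi i j k)).
  apply: eq_bigr => i _.
  rewrite exchange_big [RHS]exchange_big; apply: eq_bigr => k _ /=.
  rewrite -(@sum_shift M (fun j => c' (i + j + k)%N * psi i j k)).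
    by apply: eq_bigr => j _; rewrite /th !addnS !addSn /= mulrA.
  by rewrite psi0 ?leqnn ?orbT ?mulr0.
have X3 : sum3 M (fun i j k => th k (i + j + k) * psi i j k.+1) =
    sum3 M (fun i j k => k%:R * (c' (i + j + k)%N * psi i j k)).
  apply: eq_bigr => i _; apply: eq_bigr => j _ /=.
  rewrite -(@sum_shift M (fun k => c' (i + j + k)%N * psi i j k)).
    by apply: eq_bigr => k _; rewrite /th !addnS /= mulrA.
  by rewrite psi0 ?leqnn ?orbT ?mulr0.
transitivity (sum3 M (fun i j k => (th i (i + j + k) + th j (i + j + k) +
    th k (i + j + k)) * psi i j k) -
  (sum3 M (fun i j k => th i (i + j + k) * psi i.+1 j k) +
   (sum3 M (fun i j k => th j (i + j + k) * psi i j.+1 k) +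
    sum3 M (fun i j k => th k (i + j + k) * psi i j k.+1)))).
  rewrite -!sum3D -[X in _ - X]mul1r -mulNr -sum3Z -sum3D.
  by apply: eq_sum3 => i j k; ring.
rewrite X1 X2 X3 -!sum3D -[X in _ - X]mul1r -mulNr -sum3Z -sum3D.
(* At level [n] the outflow is [2 / ((n + 1) (n + 2))] and the inflow [n * c' n]; they agree unless
   [n = 0], where the difference is 1. *)
transitivity (sum3 M (fun i j k =>
    if (i + j + k == 0)%N then psi 0%N 0%N 0%N else 0)).
  apply: eq_sum3 => i j k.
  have -> : th i (i + j + k) + th j (i + j + k) + th k (i + j + k) =
      2 / ((i + j + k).+1%:R * (i + j + k).+2%:R).
    rewrite /th -!mulrDl -!natrD (_ : (i.+1 + j.+1 + k.+1)%N = (i + j + k).+3); last by lia.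
    exact: flow_coefE.
  case: eqP => [|/eqP].
    move/eqP; rewrite !addn_eq0 => /andP[/andP[/eqP -> /eqP ->] /eqP ->].
    by rewrite /= !mul0r !addr0 mulr0 addr0; field.
  rewrite -lt0n => n0.
  have E3 : i%:R + j%:R + k%:R = (i + j + k)%:R :> R by rewrite -!natrD.
  transitivity ((2 / ((i + j + k).+1%:R * (i + j + k).+2%:R) -
    (i + j + k)%:R * c' (i + j + k)%N) * psi i j k); first by rewrite -E3; ring.
  case: (i + j + k)%N n0 => // n _.
  by rewrite /= flow_coefS subrr mul0r.
case: M M0 => // m _; rewrite /sum3 big_ord_recl [X in _ + X]big1 ?addr0; last first.
  by move=> i _; rewrite big1// => j _; rewrite big1.
rewrite big_ord_recl [X in _ + X]big1 ?addr0; last first.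
  by move=> j _; rewrite big1.
by rewrite big_ord_recl [X in _ + X]big1 ?addr0.
Qed.

Let inv_prod p n : R := (\prod_(q < p) (n + q.+1)%:R)^-1.

(** At a vertex of level [n] the squares of the three outflows sum to at most the square of their
    total [2 / ((n + 1) (n + 2))], which is at most [24 * inv_prod 4 n], with equality at [n = 0].
    The identity [p * inv_prod p.+1 n = inv_prod p n - inv_prod p n.+1] telescopes in each of the
    three coordinates, with factors 3, 2, 1, and leaves [24 / 6 = 4]. *)
Lemma flow_energy : sum3 M (fun i j k => th i (i + j + k) ^+ 2 +
  (th j (i + j + k) ^+ 2 + th k (i + j + k) ^+ 2)) <= 4.
Proof.
have tele p a m : (0 < p)%N -> p%:R * \sum_(k < m) inv_prod p.+1 (a + k) <= inv_prod p a.
  move=> p0.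
  suff : p%:R * \sum_(k < m) inv_prod p.+1 (a + k) = inv_prod p a - inv_prod p (a + m).
    by move=> ->; rewrite gerBl invr_ge0 prodr_ge0.
  elim: m => [|m IH]; first by rewrite big_ord0 mulr0 addn0 subrr.
  rewrite big_ord_recr /= mulrDr IH.
  have E1 : inv_prod p.+1 (a + m) = inv_prod p (a + m) / (a + m + p.+1)%:R.
    by rewrite /inv_prod big_ord_recr /= invfM.
  have E2 : inv_prod p.+1 (a + m) = inv_prod p (a + m.+1) / (a + m + 1)%:R.
    rewrite /inv_prod big_ord_recl /= invfM mulrC; congr (_^-1 / _).
    by apply: eq_bigr => q _; congr _%:R; rewrite /bump /=; lia.
  have n1 : (a + m + p.+1)%:R != 0 :> R by rewrite pnatr_eq0; lia.
  have n2 : (a + m + 1)%:R != 0 :> R by rewrite pnatr_eq0; lia.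
  have E1' : inv_prod p (a + m) = inv_prod p.+1 (a + m) * (a + m + p.+1)%:R.
    by rewrite E1 divfK.
  have E2' : inv_prod p (a + m.+1) = inv_prod p.+1 (a + m) * (a + m + 1)%:R.
    by rewrite E2 divfK.
  have -> : p%:R = (a + m + p.+1)%:R - (a + m + 1)%:R :> R.
    by apply/eqP; rewrite eq_sym subr_eq -natrD; apply/eqP; congr _%:R; lia.
  rewrite E1' E2'; ring.
have B i j k : th i (i + j + k) ^+ 2 + (th j (i + j + k) ^+ 2 + th k (i + j + k) ^+ 2)
    <= 24 * inv_prod 4 (i + j + k).
  have -> : inv_prod 4 (i + j + k) = ((i + j + k).+1%:R * (i + j + k).+2%:R *
      (i + j + k).+3%:R * (i + j + k).+4%:R)^-1.
    by rewrite /inv_prod !big_ord_recl big_ord0 /= /bump /= !addnS !addn0 mulr1 !mulrA.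
  have En : i.+1%:R + j.+1%:R + k.+1%:R = (i + j + k).+3%:R :> R.
    by rewrite -!natrD; congr _%:R; lia.
  move: En; set n := (i + j + k)%N; move=> En.
  apply: (@le_trans _ _ ((n.+3%:R * flow_coef n) ^+ 2)).
    rewrite -En /th !exprMn -!mulrDl ler_wpM2r ?sqr_ge0//.
    have := ler0n R i.+1; have := ler0n R j.+1; have := ler0n R k.+1; nra.
  have n1 : 1 <= n.+1%:R :> R by rewrite ler1n.
  have E2 : n.+2%:R = n.+1%:R + 1 :> R by rewrite natr1.
  have E3 : n.+3%:R = n.+1%:R + 2 :> R by rewrite -natrD addn2.
  have E4 : n.+4%:R = n.+1%:R + 3 :> R by rewrite -natrD addn3.
  rewrite /flow_coef E2 E3 E4; move: (n.+1%:R) n1 => v v1.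
  have v0 : 0 < v by lra.
  rewrite -subr_ge0.
  have -> : 24 / (v * (v + 1) * (v + 2) * (v + 3)) - ((v + 2) * (2 / (v * (v + 1) * (v + 2)))) ^+ 2
    = (24 * v * (v + 1) - 4 * (v + 2) * (v + 3)) / ((v * (v + 1)) ^+ 2 * (v + 2) * (v + 3)).
    by field; rewrite !gt_eqF//; lra.
  apply: divr_ge0; last by rewrite !mulr_ge0 ?sqr_ge0//; lra.
  nra.
apply: (@le_trans _ _ (24 * sum3 M (fun i j k => inv_prod 4 (i + j + k)))).
  by rewrite -sum3Z; apply: le_sum3.
have L3 : 3 * sum3 M (fun i j k => inv_prod 4 (i + j + k)) <=
    \sum_(i < M) \sum_(j < M) inv_prod 3 (i + j).
  rewrite /sum3 mulr_sumr; apply: ler_sum => i _; rewrite mulr_sumr.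
  by apply: ler_sum => j _; exact: (tele 3%N).
have L2 : 2 * (\sum_(i < M) \sum_(j < M) inv_prod 3 (i + j)) <=
    \sum_(i < M) inv_prod 2 i.
  by rewrite mulr_sumr; apply: ler_sum => i _; exact: (tele 2%N).
have L1 : \sum_(i < M) inv_prod 2 i <= inv_prod 1 0.
  by have := tele 1%N 0%N M isT; rewrite mul1r; under eq_bigr do rewrite add0n.
have L0 : inv_prod 1 0 = 1 by rewrite /inv_prod big_ord_recl big_ord0 mulr1 addn1 invr1.
lra.
Qed.

(** Thomson's principle: the value at the origin is the pairing of the gradient with a unit flow of
    energy at most 4. Cauchy-Schwarz is used in the form of Young's inequality, with the optimal
    multiplier [c = p / 4]. *)
Lemma transience_orthant : psi 0%N 0%N 0%N ^+ 2 <= 4 *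
  sum3 M (fun i j k => (psi i j k - psi i.+1 j k) ^+ 2 +
    ((psi i j k - psi i j.+1 k) ^+ 2 + (psi i j k - psi i j k.+1) ^+ 2)).
Proof.
set E := sum3 M _; set p := psi 0%N 0%N 0%N; pose c := p / 4.
have : 2 * c * p - c ^+ 2 * 4 <= E.
  apply: (@le_trans _ _ (2 * c * p - c ^+ 2 * sum3 M (fun i j k => th i (i + j + k) ^+ 2 +
    (th j (i + j + k) ^+ 2 + th k (i + j + k) ^+ 2)))).
    by rewrite lerD2l lerN2 ler_wpM2l ?sqr_ge0// flow_energy.
  rewrite /p -flow_divergence -mulNr -!sum3Z -sum3D; apply: le_sum3 => i j k.
  have q (a b : R) : 2 * c * (a * b) - c ^+ 2 * a ^+ 2 <= b ^+ 2.
    by have := sqr_ge0 (c * a - b); nra.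
  have := q (th i (i + j + k)) (psi i j k - psi i.+1 j k).
  have := q (th j (i + j + k)) (psi i j k - psi i j.+1 k).
  have := q (th k (i + j + k)) (psi i j k - psi i j k.+1).
  lra.
by rewrite /c; lra.
Qed.


End flow.

(** * The Green function *)

Section green.
Variables (R : realType) (d N : nat).
Notation site := (site d).
Notation field := (field R d).
Hypothesis d3 : (3 <= d)%N.
Let d0 : (0 < d)%N. Proof. exact: leq_trans d3. Qed.

Definition grad2 (phi : field) (v : site) : R := \sum_p (phi v - phi (nbr v p)) ^+ 2.

Lemma grad2_ge0 phi v : 0 <= grad2 phi v.
Proof. by apply: sumr_ge0 => p _; exact: sqr_ge0. Qed.

Lemma Ham_grad2 phi : supp N phi ->
  8 * d%:R * Ham N phi = \sum_(v <- LamBd d N) grad2 phi v.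
Proof.
move=> s0; rewrite /Ham mulrA mulfV ?mul1r; last first.
  by rewrite mulf_neq0// pnatr_eq0 -lt0n.
rewrite big_seq [RHS]big_seq; apply: eq_bigr => v vB.
rewrite (@sum_nbrs R d N v (fun y => (phi v - phi y) ^+ 2))// => p nB.
by rewrite (supp_nbr s0 vB nB) subrr expr0n.
Qed.

Lemma grad2_eq0 phi v : supp N phi -> v \notin LamBd d N -> grad2 phi v = 0.
Proof.
move=> s0 vB; apply: big1 => p _; rewrite !s0 ?subrr ?expr0n//.
- apply: contra vB => nL; have [q <-] := nbr_sym v p; exact: nbr_LamBd.
- by apply: contra vB; exact: Lam_LamBd.
Qed.

Lemma sum_grad2_le phi (V : seq site) : supp N phi -> uniq V ->
  \sum_(v <- V) grad2 phi v <= 8 * d%:R * Ham N phi.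
Proof.
move=> s0 uV; rewrite Ham_grad2//.
rewrite (bigID (mem (LamBd d N)))/= [X in _ + X]big1 ?addr0; last first.
  by move=> v; exact: grad2_eq0.
rewrite [leRHS](bigID (mem V))/= -[leLHS]addr0 lerD//; last first.
  by apply: sumr_ge0 => v _; exact: grad2_ge0.
rewrite le_eqVlt; apply/orP; left; apply/eqP.
rewrite -big_filter -[RHS]big_filter; apply: perm_big; apply: uniq_perm.
- exact: filter_uniq.
- by rewrite filter_uniq// uniq_LamBd.
- by move=> v; rewrite !mem_filter /= andbC.
Qed.

Let e0 : 'I_d := Ordinal d0.
Let e1 : 'I_d := Ordinal (ltnW d3).
Let e2 : 'I_d := Ordinal d3.

Definition orthant (x : site) (i j k : nat) : site :=
  [ffun l : 'I_d => x l + (if l == e0 then i else if l == e1 then j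
    else if l == e2 then k else 0%N)%:Z].

Lemma orthant_nbr x i j k :
  [/\ nbr (orthant x i j k) (e0, true) = orthant x i.+1 j k,
      nbr (orthant x i j k) (e1, true) = orthant x i j.+1 k &
      nbr (orthant x i j k) (e2, true) = orthant x i j k.+1].
Proof.
split; apply/ffunP => l; rewrite !ffunE /=.
- by case: eqP => _; lia.
- by case: (eqVneq l e1) => [->|_]; rewrite /=; [lia|rewrite addr0].
- by case: (eqVneq l e2) => [->|_]; rewrite /=; [lia|rewrite addr0].
Qed.

Lemma orthant_inj x i j k i' j' k' :
  orthant x i j k = orthant x i' j' k' -> [/\ i = i', j = j' & k = k'].
Proof.
move=> /ffunP E; have := E e0; have := E e1; have := E e2.
by rewrite !ffunE /= => /addrI [] -> /addrI [] -> /addrI [] ->.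
Qed.

(** A three-dimensional orthant with corner [x] suffices in every dimension [d >= 3], since its
    edges carry part of the nonnegative terms of [Ham]. The constant is [32 = 4 * 8], whatever [N]
    is. *)
Lemma field_sqr_le (phi : field) x : supp N phi -> x \in Lam d N ->
  phi x ^+ 2 <= 32 * d%:R * Ham N phi.
Proof.
(* The coordinates of [x] are at least [- N./2], so after [M] steps in one of the three directions
   the orthant has left the box. *)
move=> s0 xL; pose M := (N./2 * 2).+1.
pose psi i j k := phi (orthant x i j k).
have psi0 i j k : (M <= i)%N || (M <= j)%N || (M <= k)%N -> psi i j k = 0.
  move=> H; apply: s0; apply: contraL H; rewrite mem_box => /forallP H.
  move: xL; rewrite mem_box => /forallP xL.
  have := H e0; have := H e1; have := H e2; have := xL e0; have := xL e1; have := xL e2.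
  by rewrite !ffunE /= !ler_norml /M; lia.
have M0 : (0 < M)%N by [].
have := transience_orthant M0 psi0.
have -> : psi 0%N 0%N 0%N = phi x.
  congr phi; apply/ffunP => l; rewrite ffunE.
  by rewrite !if_same addr0.
move=> /le_trans; apply.
rewrite (_ : 32 * d%:R * Ham N phi = 4 * (8 * d%:R * Ham N phi)); last by ring.
rewrite ler_pM2l//.
pose f (q : 'I_M * 'I_M * 'I_M) := orthant x q.1.1 q.1.2 q.2.
pose V := map f (enum {: 'I_M * 'I_M * 'I_M}).
have uV : uniq V.
  rewrite map_inj_uniq ?enum_uniq// => -[[i j] k] [[i' j'] k'].
  by rewrite /f /= => /orthant_inj[/val_inj -> /val_inj -> /val_inj ->].
apply: le_trans (sum_grad2_le s0 uV).
rewrite big_map big_enum /=.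
pose g i j k := grad2 phi (orthant x i j k).
apply: (@le_trans _ _ (sum3 M g)); last first.
  rewrite /sum3 (pair_bigA _ (fun i j : 'I_M => \sum_(k < M) g i j k)) /=.
  by rewrite (pair_bigA _ (fun (q : 'I_M * 'I_M) (k : 'I_M) => g q.1 q.2 k)) /=.
apply: le_sum3 => i j k.
have [E0 E1 E2] := orthant_nbr x i j k.
rewrite /g /grad2 (bigD1 (e0, true))//= (bigD1 (e1, true))//=.
rewrite (bigD1 (e2, true))//= E0 E1 E2 !addrA lerDl.
by apply: sumr_ge0 => p _; exact: sqr_ge0.
Qed.

Lemma Qf_sum (I : Type) (r : seq I) (c : I -> R) (w : I -> field) z :
  Qf (fun z => \sum_(i <- r) c i * w i z) z = \sum_(i <- r) c i * Qf (w i) z.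
Proof.
rewrite /Qf exchange_big mulr_sumr -sumrB; apply: eq_bigr => i _.
by rewrite mulrBr -mulr_sumr mulrCA.
Qed.

(** [Qf] is injective on fields supported in the box: if [Qf phi] vanishes there, then
    [Ham N phi = 0], and [field_sqr_le] forces [phi = 0]. A square matrix with trivial kernel is
    invertible. *)
Lemma green_exists x : x \in Lam d N ->
  exists u : field, supp N u /\
    forall z, z \in Lam d N -> Qf u z = (z == x)%:R.
Proof.
move=> xL; pose L := Lam d N; pose n := size L.
pose s (i : 'I_n) : site := nth x L i.
have sL i : s i \in L by rewrite mem_nth.
pose del (i : 'I_n) : field := fun z => (z == s i)%:R.
pose F (v : 'rV[R]_n) : field := fun z => \sum_i v 0 i * del i z.
have sF v : supp N (F v).
  move=> z zL; apply: big1 => i _; rewrite /del; case: eqP => [zs|_]; last by rewrite mulr0.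
  by move: zL; rewrite zs sL.
pose A : 'M[R]_n := \matrix_(i, j) Qf (del i) (s j).
have FA v j : (v *m A) 0 j = Qf (F v) (s j).
  by rewrite mxE /F Qf_sum; apply: eq_bigr => i _; rewrite mxE.
have Fs v j : F v (s j) = v 0 j.
  rewrite /F (bigD1 j)//= /del eqxx mulr1 big1 ?addr0// => i ij.
  case: eqP => [|_]; last by rewrite mulr0.
  move=> /eqP; rewrite nth_uniq ?uniq_Lam// => /eqP /val_inj ji.
  by rewrite ji eqxx in ij.
have Lind z : z \in L -> exists j, z = s j.
  move=> zL; have zn : (index z L < n)%N by rewrite index_mem.
  by exists (Ordinal zn); rewrite /s nth_index.
have Afree : row_free A.
  apply: inj_row_free => v vA0.
  have H0 : 2 * Ham N (F v) = 0.
    rewrite Ham_Qf// big_seq big1// => z zL; have [j ->] := Lind z zL.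
    by rewrite -FA vA0 mxE mulr0.
  apply/rowP => j; rewrite mxE -Fs; apply/eqP.
  have := field_sqr_le (sF v) (sL j).
  have -> : Ham N (F v) = 0 by lra.
  by rewrite mulr0 => H; rewrite -sqrf_eq0 eq_le H sqr_ge0.
rewrite row_free_unit in Afree.
pose v : 'rV[R]_n := (\row_j (s j == x)%:R) *m invmx A.
exists (F v); split => // z /Lind[j ->].
by rewrite -FA mulmxKV// mxE.
Qed.

(** [u] is the Green function with pole [x], and [u x] is the variance of the free field at [x].
    Upper bound: [(u x)^2 <= 32 d Ham u = 16 d u x]. Lower bound: [Ham (u - delta_x) >= 0], where
    the cross term is [-1] and [2 Ham delta_x <= 1]. *)
Lemma green_bounds (u : field) x : x \in Lam d N -> supp N u ->
  (forall z, z \in Lam d N -> Qf u z = (z == x)%:R) ->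
  [/\ 1 <= u x, u x <= 16 * d%:R & 2 * Ham N u = u x].
Proof.
move=> xL su uQ.
have pick (phi : field) : \sum_(z <- Lam d N) phi z * Qf u z = phi x.
  rewrite (bigD1_seq x) ?uniq_Lam//= uQ// eqxx mulr1 big_seq_cond big1 ?addr0//.
  by move=> z /andP[zL /negPf zx]; rewrite uQ// zx mulr0.
have Hu : 2 * Ham N u = u x by rewrite Ham_Qf// pick.
pose del : field := fun z => - (z == x)%:R.
have sdel : supp N del.
  move=> z zL; rewrite /del; case: eqP => [zx|]; last by rewrite oppr0.
  by move: zL; rewrite zx xL.
have dR : 0 < d%:R :> R by rewrite ltr0n.
have Hdel : 2 * Ham N del <= 1.
  rewrite Ham_Qf// (bigD1_seq x) ?uniq_Lam//= big1 ?addr0; last first.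
    by move=> z /negPf zx; rewrite {1}/del zx oppr0 mul0r.
  rewrite /Qf {1 2}/del eqxx mulN1r opprB opprK gerDr.
  rewrite mulr_ge0_le0 ?invr_ge0 ?mulr_ge0// sumr_le0// => p _.
  by rewrite /del oppr_le0.
split => //.
- have := Ham_ge0 N (del + u).
  have pd : del x = - 1 by rewrite /del eqxx.
  rewrite HamD bform_Qf// pick pd; lra.
- have := field_sqr_le su xL.
  have -> : 32 * d%:R * Ham N u = 16 * d%:R * u x by rewrite -Hu; ring.
  have := Ham_ge0 N u; rewrite expr2.
  have [u0 _|u0 _] := leP (u x) 0; last by rewrite ler_pM2r.
  by rewrite (le_trans u0)// mulr_ge0.
Qed.

End green.

(** * Marginals of the free field *)

Section marginal.
Variables (R : realType) (d N : nat).
Notation mu := (@lebesgue_measure R).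
Notation site := (site d).
Notation field := (field R d).
Notation L := (Lam d N).
Hypothesis d3 : (3 <= d)%N.
Let d0 : (0 < d)%N. Proof. exact: leq_trans d3. Qed.

Lemma rmeas_Ham : rmeas (@Ham R d N).
Proof.
have m x y : rmeas (fun phi : field => (phi x - phi y) ^+ 2).
  by move=> d1 T1 u mu_; apply: measurable_funX; exact: measurable_funB.
apply: (rmeasM (rmeas_cst _)).
apply: (@rmeas_sum _ _ _ _ (fun x phi => \sum_(y <- LamBd d N | dist2 x y == 1)
  (phi x - phi y) ^+ 2)) => x.
have -> : (fun phi : field => \sum_(y <- LamBd d N | dist2 x y == 1)
    (phi x - phi y) ^+ 2) = (fun phi : field =>
    \sum_(y <- [seq y <- LamBd d N | dist2 x y == 1]) (phi x - phi y) ^+ 2).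
  by apply/funext => phi; rewrite big_filter.
exact: rmeas_sum.
Qed.

Lemma rmeas_expHam : rmeas (fun phi : field => expR (- Ham N phi)).
Proof.
apply: rmeas_expR => d1 T1 u mu_.
by apply: measurableT_comp => //; exact: rmeas_Ham.
Qed.

Definition Zfree : \bar R := iint L (fun phi : field => (expR (- Ham N phi))%:E).

Lemma tilt_edges (phi : field) : supp N phi ->
  tilt L (fun=> 0) phi + (8 * d%:R)^-1 * edge_sum (edges d N) phi = - Ham N phi.
Proof.
move=> s0; rewrite Ham_edges// opprB [LHS]addrC; congr (_ + _).
rewrite /tilt -sumrN; apply: eq_bigr => x _; by rewrite mul0r addr0.
Qed.

Lemma Zfree_gt0 : (0 < Zfree)%E.
Proof.
apply: (@lt_le_trans _ _ (iint L (fun phi => (expR (tilt L (fun=> 0) phi))%:E))).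
  by rewrite iint_tilt ?uniq_Lam// lte_fin prodr_gt0// => x _; exact: gauss_mass_gt0.
apply: le_iint.
- by move=> phi; rewrite lee_fin expR_ge0.
- by move=> phi; rewrite lee_fin expR_ge0.
- exact: (rmeas_fmeas (rmeas_expR (rmeas_tilt L _))).
- exact: (rmeas_fmeas rmeas_expHam).
move=> phi s0; rewrite lee_fin ler_expR -tilt_edges// lerDl.
rewrite mulr_ge0 ?invr_ge0// /edge_sum sumr_ge0// => e _; exact: sqr_ge0.
Qed.

Lemma Lam_neq0 : (0 < size L)%N.
Proof. by rewrite size_box expn_gt0. Qed.

Lemma Zfree_lty : (Zfree < +oo)%E.
Proof.
(* Summing [field_sqr_le] over the sites gives [k * sum phi^2 <= Ham], so a product of Gaussians
   dominates. *)
pose k : R := (32 * d%:R * (size L)%:R)^-1.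
have dR : 0 < d%:R :> R by rewrite ltr0n.
have nR : 0 < (size L)%:R :> R by rewrite ltr0n Lam_neq0.
have k0 : 0 < k by rewrite invr_gt0 !mulr_gt0.
apply: (@le_lt_trans _ _ (iint L (fun phi =>
    (\prod_(x <- L) expR (- k * phi x ^+ 2 + 0 * phi x))%:E))).
  apply: le_iint.
  - by move=> phi; rewrite lee_fin expR_ge0.
  - by move=> phi; rewrite lee_fin prodr_ge0// => x _; exact: expR_ge0.
  - exact: (rmeas_fmeas rmeas_expHam).
  - exact: (rmeas_fmeas (rmeas_prod L (fun x => rmeas_coord x (measurable_expquad k 0)))).
  move=> phi s0; rewrite lee_fin -expR_sum ler_expR.
  under [leRHS]eq_bigr do rewrite mul0r addr0.
  rewrite -mulr_sumr mulNr lerN2 /k mulrC ler_pdivrMr ?mulr_gt0//.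
  apply: (@le_trans _ _ (\sum_(x <- L) 32 * d%:R * Ham N phi)).
    by rewrite big_seq [leRHS]big_seq; apply: ler_sum => x; exact: field_sqr_le.
  rewrite big_const_seq count_predT iter_addr_0 -mulr_natr.
  by rewrite le_eqVlt; apply/orP; left; apply/eqP; ring.
rewrite (@iint_prod _ _ L (fun x t => expR (- k * t ^+ 2 + 0 * t))
  (fun=> Num.sqrt (pi / k) * expR (0 ^+ 2 / (4 * k)))) ?ltry ?uniq_Lam//.
- by move=> x; exact: measurable_expquad.
- by move=> x _; exact: integral_expquad.
Qed.

Definition zfree : R := fine Zfree.

Lemma ZfreeE : Zfree = zfree%:E.
Proof. by rewrite fineK// ge0_fin_numE ?Zfree_lty// ltW// Zfree_gt0. Qed.

Lemma zfree_gt0 : 0 < zfree.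
Proof. by rewrite -lte_fin -ZfreeE Zfree_gt0. Qed.

Section site.
Variables (u : field) (x : site).
Hypothesis xL : x \in L.
Hypothesis su : supp N u.
Hypothesis uQ : forall z, z \in L -> Qf u z = (z == x)%:R.
Let u1 : 1 <= u x. Proof. by have [] := green_bounds d3 xL su uQ. Qed.
Let u0 : 0 < u x. Proof. exact: lt_le_trans ltr01 u1. Qed.

(** [u / u x] is harmonic in the box away from [x], hence orthogonal for the Dirichlet form to every
    supported field vanishing at [x]; the energies add. *)
Lemma Ham_fiber (phi : field) (t : R) : supp N phi -> phi x = 0 ->
  Ham N (phi + (fun z => t * (u z / u x))) = Ham N phi + t ^+ 2 / (2 * u x).
Proof.
move=> s0 px; have [_ _ Hu] := green_bounds d3 xL su uQ.
set w : field := fun z => _.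
have wE z : w z = t / u x * u z by rewrite /w mulrA mulrAC.
have QW z : z \in L -> Qf w z = t / u x * (z == x)%:R.
  move=> zL; rewrite -uQ// /Qf wE; under eq_bigr do rewrite wE.
  by rewrite -mulr_sumr; ring.
have pick (psi : field) : \sum_(z <- L) psi z * Qf w z = psi x * (t / u x).
  rewrite (bigD1_seq x) ?uniq_Lam//= QW// eqxx mulr1 big_seq_cond big1 ?addr0//.
  by move=> z /andP[zL /negPf zx]; rewrite QW// zx !mulr0.
rewrite HamD bform_Qf// pick px mul0r addr0; congr (_ + _).
have sw : supp N w by move=> z zL; rewrite /w su// mul0r mulr0.
have : 2 * Ham N w = t * (t / u x).
  by rewrite Ham_Qf// pick /w divff ?mulr1// gt_eqF.
move=> E; rewrite -[Ham N w]mul1r -(@mulVf _ (2 : R))// -mulrA E.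
by field; rewrite gt_eqF.
Qed.

(** Given [phi x = t], removing the harmonic profile [t * u / u x] from the other coordinates splits
    the energy into a function of [t] and a function of the rest. *)
Lemma iint_marginal (g : R -> R) : (forall t, 0 <= g t) -> measurable_fun setT g ->
  (iint L (fun phi => (g (phi x) * expR (- Ham N phi))%:E) =
   (\int[mu]_t (g t * expR (- t ^+ 2 / (2 * u x)))%:E) *
   iint (rem x L) (fun phi => (expR (- Ham N (upd phi x 0%R)))%:E))%E.
Proof.
move=> g0 mg.
have mH := rmeas_fmeas rmeas_expHam.
rewrite (@iint_front _ _ L _ x) ?uniq_Lam//; last 2 first.
- by move=> phi; rewrite lee_fin mulr_ge0// expR_ge0.
- exact: (rmeas_fmeas (rmeasM (rmeas_coord x mg) rmeas_expHam)).
rewrite [LHS]/= -ge0_integralZr//; last 3 first.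
- apply/measurable_EFinP; apply: measurable_funM => //.
  apply: measurableT_comp => //; apply: measurable_funM => //.
  by apply: measurableT_comp => //; exact: measurable_funX.
- by move=> t _; rewrite lee_fin mulr_ge0// expR_ge0.
- by apply: iint_ge0 => phi; rewrite lee_fin expR_ge0.
apply: eq_integral => t _.
have zrem z : z \notin rem x L -> z = x \/ z \notin L.
  by rewrite mem_rem_uniq ?uniq_Lam// inE negb_and negbK => /orP[/eqP|]; [left|right].
(* The coordinate [x] already holds [t], so the profile is erased there. *)
rewrite (@iint_translate _ _ _ _ (upd (fun z => t * (u z / u x)) x 0)); last 3 first.
- by move=> phi; rewrite lee_fin mulr_ge0// expR_ge0.
- exact: (fmeas_upd x t (rmeas_fmeas (rmeasM (rmeas_coord x mg) rmeas_expHam))).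
- move=> z /zrem; rewrite /upd; case: eqP => // _ [//|zL].
  by rewrite su// mul0r mulr0.
rewrite -iintZl; last 3 first.
- by rewrite mulr_ge0// expR_ge0.
- by move=> phi; rewrite lee_fin expR_ge0.
- exact: (fmeas_upd x 0 mH).
apply: eq_iint_supp => phi s0.
have s1 : supp N (upd phi x 0).
  by move=> z zL; rewrite /upd; case: eqP => // _; apply: s0; apply: contra zL; exact: mem_rem.
have px : upd phi x 0 x = 0 by rewrite /upd eqxx.
have -> : upd (phi + upd (fun z => t * (u z / u x)) x 0) x t =
    upd phi x 0 + (fun z => t * (u z / u x)).
  apply/funext => z; rewrite /upd !fctE; case: eqP => // ->.
  by rewrite divff ?mulr1 ?add0r// gt_eqF.
rewrite Ham_fiber// -EFinM; congr EFin.
rewrite !fctE px add0r divff ?gt_eqF// mulr1 opprD expRD mulrCA mulrC mulNr.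
by rewrite -mulrA mulrC.
Qed.

(** The leftover integral over the other sites is identified by the case [g = 1], where the left
    side is [zfree]; finiteness of [zfree] excludes an infinite value. *)
Lemma marginalE (g : R -> R) (G : R) : (forall t, 0 <= g t) -> measurable_fun setT g ->
  (\int[mu]_t (g t * expR (- t ^+ 2 / (2 * u x)))%:E = G%:E)%E ->
  (iint L (fun phi => (g (phi x) * expR (- Ham N phi))%:E) =
   (G / Num.sqrt (2 * pi * u x) * zfree)%:E)%E.
Proof.
move=> g0 mg gG; rewrite iint_marginal// gG.
have k0 : 0 < (2 * u x)^-1 by rewrite invr_gt0 mulr_gt0.
have := iint_marginal (fun=> ler01) (measurable_cst (1 : R)).
under eq_iint do rewrite mul1r.
under eq_integral => t _.
  rewrite mul1r (_ : - t ^+ 2 / (2 * u x) = - (2 * u x)^-1 * t ^+ 2 + 0 * t); last first.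
    by rewrite mul0r addr0 mulNr mulrC mulNr.
  over.
rewrite integral_expquad// expr0n mul0r expR0 mulr1 invrK -/Zfree ZfreeE.
rewrite (_ : pi * (2 * u x) = 2 * pi * u x); last by ring.
have q0 : 0 < Num.sqrt (2 * pi * u x) by rewrite sqrtr_gt0 !mulr_gt0// pi_gt0.
set I := iint _ _; have I0 : (0 <= I)%E by apply: iint_ge0 => phi; rewrite lee_fin expR_ge0.
case: I I0 => [r|//|//] _.
  by rewrite -EFinM => -[->]; rewrite -EFinM mulrA divfK// gt_eqF.
by rewrite gt0_muley ?lte_fin.
Qed.

End site.

Section bound.
Variables (f th rho : site -> R -> R) (F Th Rho : site -> R -> R).
Variables (u : site -> field) (thb rhob : site -> R).
Hypothesis f0 : forall x t, 0 <= f x t.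
Hypothesis th0 : forall x t, 0 <= th x t.
Hypothesis rho0 : forall x t, 0 <= rho x t.
Hypothesis mf : forall x, measurable_fun setT (f x).
Hypothesis mth : forall x, measurable_fun setT (th x).
Hypothesis mrho : forall x, measurable_fun setT (rho x).
Hypothesis fF : forall x s, x \in L ->
  (\int[mu]_t (f x t * expR (- t ^+ 2 + s * t))%:E = (F x s)%:E)%E.
Hypothesis thF : forall x s, x \in L ->
  (\int[mu]_t (th x t * expR (- t ^+ 2 + s * t))%:E = (Th x s)%:E)%E.
Hypothesis rhoF : forall x s, x \in L ->
  (\int[mu]_t (rho x t * expR (- t ^+ 2 + s * t))%:E = (Rho x s)%:E)%E.
Hypothesis fthrho : forall x s, x \in L ->
  gauss_mass s * expR ((Th x s - Rho x s) / gauss_mass s) <= F x s.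
Hypothesis su : forall x, x \in L -> supp N (u x).
Hypothesis uQ : forall x, x \in L ->
  forall z, z \in L -> Qf (u x) z = (z == x)%:R.
Hypothesis thM : forall x, x \in L ->
  (\int[mu]_t (th x t * expR (- t ^+ 2 / (2 * u x x)))%:E =
   (thb x * Num.sqrt (2 * pi * u x x))%:E)%E.
Hypothesis rhoM : forall x, x \in L ->
  (\int[mu]_t (rho x t * expR (- t ^+ 2 / (2 * u x x)))%:E =
   (rhob x * Num.sqrt (2 * pi * u x x))%:E)%E.

Let iint_sumM (g : site -> R -> R) (gb : site -> R) : (forall x t, 0 <= g x t) ->
  (forall x, measurable_fun setT (g x)) ->
  (forall x, x \in L -> (\int[mu]_t (g x t * expR (- t ^+ 2 / (2 * u x x)))%:E =
    (gb x * Num.sqrt (2 * pi * u x x))%:E)%E) ->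
  iint L (fun phi => ((\sum_(x <- L) g x (phi x)) * expR (- Ham N phi))%:E) =
  ((\sum_(x <- L) gb x) * zfree)%:E.
Proof.
move=> g0 mg gM.
transitivity (iint L (fun phi => \sum_(x <- L)
    (g x (phi x) * expR (- Ham N phi))%:E)%E).
  by apply: eq_iint => phi; rewrite mulr_suml sumEFin.
rewrite (@iint_sum _ _ _ L L (fun x phi => (g x (phi x) * expR (- Ham N phi))%:E)).
- rewrite mulr_suml -sumEFin; apply: eq_big_seq => x xL.
  have u1 : 0 < u x x.
    by have [+ _ _] := green_bounds d3 xL (su xL) (uQ xL); exact: lt_le_trans.
  rewrite (@marginalE (u x) x xL (su xL) (uQ xL) _ _ (g0 x) (mg x) (gM x xL)).
  by rewrite mulfK// gt_eqF// sqrtr_gt0 !mulr_gt0// pi_gt0.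
- by move=> x phi; rewrite lee_fin mulr_ge0// expR_ge0.
- by move=> x; exact: (rmeas_fmeas (rmeasM (rmeas_coord x (mg x)) rmeas_expHam)).
Qed.

Lemma iint_prod_ge T : 0 <= T -> T <= \sum_(x <- L) (thb x - rhob x) ->
  ((zfree * expR T)%:E <=
   iint L (fun phi => ((\prod_(x <- L) f x (phi x)) * expR (- Ham N phi))%:E))%E.
Proof.
move=> T0 TS.
have c0 : 0 < (8 * d%:R)^-1 :> R by rewrite invr_gt0 mulr_gt0// ltr0n.
(* Zero tilt and weight [1 / (8 d)] on the edges reassemble [expR (- Ham)] from the tilted
   products. *)
have := iint_mixture_le (uniq_Lam d N) (obs_lo_ge0 L th0)
  (fun phi => obs_hi_ge0 L f0 rho0 phi T0) (rmeas_obs_lo L mth)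
  (rmeas_obs_hi L mf mrho T)
  (fun s => iint_tilt_le (uniq_Lam d N) f0 th0 rho0 mf mth mrho fF thF rhoF fthrho s T0)
  (edges d N) (fun=> 0) c0.
set I := iint L (fun phi => ((\prod_(x <- L) f x (phi x)) * _)%:E).
have I0 : (0 <= I)%E.
  by apply: iint_ge0 => phi; rewrite lee_fin mulr_ge0 ?prodr_ge0 ?expR_ge0.
have mE := rmeas_expHam.
have e0 (phi : field) : 0 <= expR (- Ham N phi) by exact: expR_ge0.
have msum (g : site -> R -> R) : (forall x, measurable_fun setT (g x)) ->
    rmeas (fun phi : field => \sum_(x <- L) g x (phi x)).
  move=> mg; exact: (rmeas_sum L (fun x => rmeas_coord x (mg x))).
have mprod : rmeas (fun phi : field => \prod_(x <- L) f x (phi x)).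
  exact: (rmeas_prod L (fun x => rmeas_coord x (mf x))).
rewrite [X in (X <= _)%E -> _](_ : _ = (zfree + (\sum_(x <- L) thb x) * zfree)%:E); last first.
  rewrite EFinD -ZfreeE -(iint_sumM th0 mth thM) -iintD//.
  - apply: eq_iint_supp => phi s0; rewrite tilt_edges// /obs_lo.
    by rewrite mulrDl mul1r EFinD.
  - by move=> phi; rewrite lee_fin mulr_ge0// sumr_ge0.
  - exact: rmeas_fmeas.
  - exact: (rmeas_fmeas (rmeasM (msum _ mth) mE)).
rewrite [X in (_ <= X)%E -> _](_ : _ = ((expR (- T))%:E * I +
    ((\sum_(x <- L) rhob x) * zfree + T * zfree)%:E)%E); last first.
  rewrite EFinD -(iint_sumM rho0 mrho rhoM) (EFinM T) -ZfreeE.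
  rewrite -iintZl ?expR_ge0//; last 2 first.
  - by move=> phi; rewrite lee_fin mulr_ge0 ?prodr_ge0.
  - exact: (rmeas_fmeas (rmeasM mprod mE)).
  rewrite -iintZl//; last exact: rmeas_fmeas.
  rewrite -iintD//; last 4 first.
  - by move=> phi; rewrite lee_fin mulr_ge0// sumr_ge0.
  - by move=> phi; rewrite -EFinM lee_fin mulr_ge0.
  - exact: (rmeas_fmeas (rmeasM (msum _ mrho) mE)).
  - exact: (rmeas_fmeas (rmeasM (rmeas_cst T) mE)).
  rewrite -iintD//; last 4 first.
  - by move=> phi; rewrite -EFinM lee_fin mulr_ge0 ?expR_ge0// mulr_ge0 ?prodr_ge0.
  - by move=> phi; rewrite -EFinM -EFinD lee_fin addr_ge0// mulr_ge0// sumr_ge0.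
  - exact: (rmeas_fmeas (rmeasM (rmeas_cst _) (rmeasM mprod mE))).
  - exact: (rmeas_fmeas (rmeasD (rmeasM (msum _ mrho) mE) (rmeasM (rmeas_cst T) mE))).
  apply: eq_iint_supp => phi s0; rewrite tilt_edges// -!EFinM -!EFinD /obs_hi.
  by congr EFin; ring.
case: I I0 => [r|//|//] _; last by rewrite leey.
rewrite -EFinM -EFinD !lee_fin => H.
have z0 := zfree_gt0.
(* By [TS] the factor [1 + sum thb - sum rhob - T] is at least 1. *)
have : zfree <= expR (- T) * r.
  have : zfree * (1 + \sum_(x <- L) thb x - \sum_(x <- L) rhob x - T) <= expR (- T) * r by lra.
  apply: le_trans; rewrite ler_peMr ?(ltW z0)//.
  by move: TS; rewrite sumrB; lra.
by rewrite expRN mulrC ler_pdivlMr ?expR_gt0.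
Qed.

End bound.
End marginal.

(** * One-site estimates *)

Section one_site.
Variable R : realType.
Notation mu := (@lebesgue_measure R).
Implicit Types (f g w : R -> R) (s t : R).

Lemma le_integral_fin f g : (forall t, 0 <= f t) -> (forall t, f t <= g t) ->
  measurable_fun setT f -> measurable_fun setT g ->
  (\int[mu]_t (f t)%:E <= \int[mu]_t (g t)%:E)%E.
Proof.
move=> f0 fg mf mg; apply: ge0_le_integral => //.
- by move=> t _; rewrite lee_fin.
- exact/measurable_EFinP.
- exact/measurable_EFinP.
- by move=> t _; rewrite lee_fin.
Qed.

Lemma integralZ_fin f (c G : R) : 0 <= c -> (forall t, 0 <= f t) ->
  measurable_fun setT f -> (\int[mu]_t (f t)%:E = G%:E)%E ->
  (\int[mu]_t (c * f t)%:E = (c * G)%:E)%E.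
Proof.
move=> c0 f0 mf E; under eq_integral do rewrite EFinM.
rewrite ge0_integralZl_EFin//; first by rewrite E.
- by move=> t _; rewrite lee_fin.
- exact/measurable_EFinP.
Qed.

Lemma integralD_fin f g (F G : R) : (forall t, 0 <= f t) -> (forall t, 0 <= g t) ->
  measurable_fun setT f -> measurable_fun setT g ->
  (\int[mu]_t (f t)%:E = F%:E)%E -> (\int[mu]_t (g t)%:E = G%:E)%E ->
  (\int[mu]_t (f t + g t)%:E = (F + G)%:E)%E.
Proof.
move=> f0 g0 mf mg EF EG; under eq_integral do rewrite EFinD.
rewrite ge0_integralD//; first by rewrite EF EG.
- by move=> t _; rewrite lee_fin.
- exact/measurable_EFinP.
- by move=> t _; rewrite lee_fin.
- exact/measurable_EFinP.
Qed.

Lemma integral_bounded w g (M W : R) : (forall t, 0 <= w t) ->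
  measurable_fun setT w -> (\int[mu]_t (w t)%:E = W%:E)%E ->
  (forall t, 0 <= g t <= M) -> measurable_fun setT g ->
  (\int[mu]_t (g t * w t)%:E = (fine (\int[mu]_t (g t * w t)%:E))%:E)%E /\
  fine (\int[mu]_t (g t * w t)%:E)%E <= M * W.
Proof.
move=> w0 mw wW gM mg.
have g0 t : 0 <= g t by have /andP[] := gM t.
have M0 : 0 <= M by have /andP[] := gM 0; exact: le_trans.
have le : (\int[mu]_t (g t * w t)%:E <= (M * W)%:E)%E.
  rewrite -(integralZ_fin M0 w0 mw wW); apply: le_integral_fin => //.
  - by move=> t; rewrite mulr_ge0.
  - by move=> t; rewrite ler_wpM2r//; have /andP[] := gM t.
  - exact: measurable_funM.
  - exact: measurable_funM.
have E : (\int[mu]_t (g t * w t)%:E = (fine (\int[mu]_t (g t * w t)%:E))%:E)%E.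
  rewrite fineK// ge0_fin_numE ?(le_lt_trans le) ?ltry//.
  by apply: integral_ge0 => t _; rewrite lee_fin mulr_ge0.
by split => //; rewrite -lee_fin -E.
Qed.

Definition tilted_int g s : R := fine (\int[mu]_t (g t * expR (- t ^+ 2 + s * t))%:E)%E.

Lemma tilted_intE g M s : (forall t, 0 <= g t <= M) -> measurable_fun setT g ->
  (\int[mu]_t (g t * expR (- t ^+ 2 + s * t))%:E = (tilted_int g s)%:E)%E.
Proof.
move=> gM mg.
by have [] := integral_bounded (fun t => expR_ge0 _) (measurable_tilt s)
  (integral_gauss_mass s) gM mg.
Qed.

Lemma tilted_int_le g M s : (forall t, 0 <= g t <= M) -> measurable_fun setT g ->
  tilted_int g s <= M * gauss_mass s.
Proof.
move=> gM mg.
by have [] := integral_bounded (fun t => expR_ge0 _) (measurable_tilt s)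
  (integral_gauss_mass s) gM mg.
Qed.

Lemma tilted_int_eq g s G : (\int[mu]_t (g t * expR (- t ^+ 2 + s * t))%:E = G%:E)%E ->
  tilted_int g s = G.
Proof. by rewrite /tilted_int => ->. Qed.

Lemma integral_indic_itv (l r : R) : l <= r ->
  (\int[mu]_t (\1_(`[l, r]%classic) t : R)%:E = (r - l)%:E)%E.
Proof.
move=> lr; rewrite integral_indic//= setIT lebesgue_measure_itv/= lte_fin.
by case: ltgtP lr => // -> _; rewrite subrr.
Qed.

Lemma indic_ge0_le1 (A : set R) t : 0 <= (\1_A t : R) <= 1.
Proof. by rewrite indicE ler0n lern1 leq_b1. Qed.

Lemma measurable_indic_itv (l r : R) :
  measurable_fun setT (\1_(`[l, r]%classic) : R -> R).
Proof. exact: measurable_indic. Qed.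

Lemma indic_itvE (l r t : R) : (\1_(`[l, r]%classic) t : R) = ((l <= t <= r)%R)%:R.
Proof. by rewrite indicE; congr (nat_of_bool _)%:R; apply/idP/idP; rewrite inE/= in_itv. Qed.

(** [th] measures the gain and [rho] the loss: the last clause bounds the average of [f], for every
    conditional mean [s / 2], below by the exponential of the average of [th - rho]. *)
Definition site_triple (f th rho : R -> R) : Prop :=
  [/\ forall t, [/\ 0 <= f t, 0 <= th t & 0 <= rho t],
      [/\ measurable_fun setT f, measurable_fun setT th & measurable_fun setT rho],
      forall s, [/\ (\int[mu]_t (f t * expR (- t ^+ 2 + s * t))%:E = (tilted_int f s)%:E)%E,
        (\int[mu]_t (th t * expR (- t ^+ 2 + s * t))%:E = (tilted_int th s)%:E)%E &
        (\int[mu]_t (rho t * expR (- t ^+ 2 + s * t))%:E = (tilted_int rho s)%:E)%E] &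
      forall s, gauss_mass s * expR ((tilted_int th s - tilted_int rho s) / gauss_mass s) <= tilted_int f s].

Lemma gauss_mass_shift s (h : R) :
  gauss_mass (s + 2 * h) = gauss_mass s * expR (h ^+ 2 + s * h).
Proof. by rewrite /gauss_mass -[RHS]mulrA -expRD; congr (_ * expR _); field. Qed.

(** Raising the site by [h] raises the mean [s / 2] by [h], that is, the tilt by [2 h]; the
    prefactor comes from completing the square. *)
Lemma tilted_int_shift g s (h : R) M : (forall t, 0 <= g t <= M) -> measurable_fun setT g ->
  tilted_int (fun t => g (t + h)) s = expR (- (h ^+ 2 + s * h)) * tilted_int g (s + 2 * h).
Proof.
move=> gM mg; have g0 t : 0 <= g t by have /andP[] := gM t.
pose G t := g t * expR (- (t - h) ^+ 2 + s * (t - h)).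
apply: tilted_int_eq.
transitivity (\int[mu]_t (G (t + h))%:E)%E.
  by apply: eq_integral => t _; rewrite /G addrK.
rewrite (@ge0_integral_shift R h (EFin \o G)); last 2 first.
- apply/measurable_EFinP; apply: measurable_funM => //.
  apply: (@measurableT_comp _ _ _ _ _ _ (fun t => expR (- t ^+ 2 + s * t))).
    exact: measurable_tilt.
  exact: measurable_shift.
- by move=> t; rewrite lee_fin mulr_ge0// expR_ge0.
rewrite -(integralZ_fin (f := fun t => g t * expR (- t ^+ 2 + (s + 2 * h) * t)))//.
- apply: eq_integral => t _; rewrite /= /G; congr EFin.
  rewrite mulrCA -expRD; congr (_ * expR _); ring.
- by move=> t; rewrite mulr_ge0// expR_ge0.
- by apply: measurable_funM => //; exact: measurable_tilt.
- exact: (tilted_intE _ gM mg).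
Qed.

Lemma sqr_le_expR (y : R) : 0 <= y -> y ^+ 2 <= 4 * expR y.
Proof.
move=> y0; have -> : expR y = expR (y / 2) ^+ 2.
  by rewrite expr2 -expRD; congr expR; field.
by have := expR_ge1Dx (y / 2); nra.
Qed.

Lemma gauss_mass_le s : gauss_mass s <= expR (Num.sqrt pi + s ^+ 2 / 4).
Proof.
rewrite expRD ler_wpM2r ?expR_ge0//.
by apply: le_trans (expR_ge1Dx _); rewrite lerDr.
Qed.

(* On [[0, 1]] the exponent [- t^2 + s t] is at least [- 1 - |s|]. *)
Lemma tilted_int_unit_ge g M s : (forall t, 0 <= g t <= M) -> measurable_fun setT g ->
  (forall t, 0 <= t <= 1 -> 1 <= g t) -> expR (- 1 - `|s|) <= tilted_int g s.
Proof.
move=> gM mg g1; rewrite -lee_fin -(tilted_intE s gM mg).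
rewrite -[X in (X%:E <= _)%E]mulr1.
have E := @integral_indic_itv 0 1 ler01; rewrite subr0 in E.
have I0 t : 0 <= (\1_(`[0, 1]%classic) t : R) by have /andP[] := indic_ge0_le1 `[0, 1] t.
rewrite -(integralZ_fin (expR_ge0 _) I0 (measurable_indic_itv 0 1) E).
apply: le_integral_fin.
- by move=> t; rewrite mulr_ge0 ?expR_ge0.
- move=> t; rewrite indic_itvE; case: (boolP (0 <= t <= 1)) => [/andP[t0 t1]|_] /=; last first.
    by rewrite mulr0 mulr_ge0 ?expR_ge0//; have /andP[] := gM t.
  rewrite mulr1 -[leLHS]mul1r ler_pM ?expR_ge0 ?g1 ?t0//.
  rewrite ler_expR; have := ler_norm (- s); rewrite normrN => sN.
  have s0 : 0 <= `|s| by []; move: `|s| s0 sN => r r0 sN; nra.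
- by apply: measurable_funM => //; exact: measurable_indic.
- by apply: measurable_funM => //; exact: measurable_tilt.
Qed.

(** The average of [f] under tilt [s] decays like [e^(- s^2 / 4)] up to lower order in the exponent,
    so the loss must grow quadratically in [s]. The average of [e^t + e^(-t)] grows like
    [e^(|s| / 2)] and is more than enough. *)
Lemma boundary_triple (h : R) : 0 <= h ->
  site_triple (fun t => \1_(`[0, 1]%classic) t * expR (- h)) (fun=> 0)
    (fun t => h + 1 + Num.sqrt pi + 6 * (expR t + expR (- t))).
Proof.
move=> h0.
have sp : 0 <= Num.sqrt (pi : R) by exact: sqrtr_ge0.
have fM t : 0 <= (\1_(`[0, 1]%classic) t : R) * expR (- h) <= 1.
  have /andP[i0 i1] := indic_ge0_le1 `[0, 1] t.
  by rewrite mulr_ge0 ?expR_ge0//= mulr_ile1 ?expR_ge0// -expR0 ler_expR oppr_le0.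
have mf : measurable_fun setT (fun t : R => (\1_(`[0, 1]%classic) t : R) * expR (- h)).
  by apply: measurable_funM => //; exact: measurable_indic.
have me s : measurable_fun setT (fun t : R => expR (s * t)).
  by apply: measurableT_comp => //; exact: measurable_funM.
have int_exp s l : (\int[mu]_t (expR (l * t) * expR (- t ^+ 2 + s * t))%:E =
    (gauss_mass (s + l))%:E)%E.
  rewrite -integral_gauss_mass; apply: eq_integral => t _; rewrite -expRD.
  by congr (expR _)%:E; ring.
pose K := h + 1 + Num.sqrt pi.
have K0 : 0 <= K by rewrite !addr_ge0.
have rhoE s : (\int[mu]_t ((K + 6 * (expR t + expR (- t))) * expR (- t ^+ 2 + s * t))%:E =
    (K * gauss_mass s + 6 * (gauss_mass (s + 1) + gauss_mass (s - 1)))%:E)%E.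
  have mt := measurable_tilt s.
  have e0 t : 0 <= expR (- t ^+ 2 + s * t) by exact: expR_ge0.
  have m1 := measurable_funM (me 1) mt; have m2 := measurable_funM (me (-1)) mt.
  have e1 t : 0 <= expR (1 * t) * expR (- t ^+ 2 + s * t) by rewrite mulr_ge0 ?expR_ge0.
  have e2 t : 0 <= expR (-1 * t) * expR (- t ^+ 2 + s * t) by rewrite mulr_ge0 ?expR_ge0.
  have H12 := integralD_fin e1 e2 m1 m2 (int_exp s 1) (int_exp s (-1)).
  have e12 t : 0 <= expR (1 * t) * expR (- t ^+ 2 + s * t) +
      expR (-1 * t) * expR (- t ^+ 2 + s * t) by rewrite addr_ge0.
  have m12 := measurable_funD m1 m2.
  have H6 := integralZ_fin (ler0n R 6) e12 m12 H12.
  have HK := integralZ_fin K0 e0 mt (integral_gauss_mass s).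
  have mK := measurable_funM (measurable_cst K) mt.
  have m6 := measurable_funM (measurable_cst (6 : R)) m12.
  rewrite -(integralD_fin (fun t => mulr_ge0 K0 (e0 t))
    (fun t => mulr_ge0 (ler0n R 6) (e12 t)) mK m6 HK H6).
  by apply: eq_integral => t _; rewrite mul1r mulN1r; congr EFin; ring.
have th0 s : tilted_int (fun=> 0) s = 0.
  by rewrite /tilted_int; under eq_integral do rewrite mul0r; rewrite integral0.
split.
- move=> t; have /andP[? _] := fM t; split => //.
  by apply: addr_ge0 => //; rewrite mulr_ge0// addr_ge0 ?expR_ge0.
- split => //; apply: measurable_funD => //; apply: measurable_funM => //.
  apply: measurable_funD; first by have := me 1; under eq_fun do rewrite mul1r.
  by have := me (-1); under eq_fun do rewrite mulN1r.
- move=> s; split; first exact: (tilted_intE s fM mf).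
  + by rewrite th0; under eq_integral do rewrite mul0r; rewrite integral0.
  + by rewrite (tilted_int_eq (rhoE s)).
move=> s; rewrite th0 (tilted_int_eq (rhoE s)) sub0r.
set i1 := fun t : R => (\1_(`[0, 1]%classic) t : R).
have -> : tilted_int (fun t => i1 t * expR (- h)) s = expR (- h) * tilted_int i1 s.
  apply: tilted_int_eq; rewrite -(integralZ_fin (expR_ge0 _) _ _
    (tilted_intE s (indic_ge0_le1 _) (measurable_indic_itv 0 1))).
  - by apply: eq_integral => t _; rewrite /i1 mulrAC mulrC.
  - by move=> t; rewrite mulr_ge0 ?expR_ge0//; have /andP[] := indic_ge0_le1 `[0, 1] t.
  - by apply: measurable_funM; [exact: measurable_indic|exact: measurable_tilt].
apply: (@le_trans _ _ (expR (- h) * expR (- 1 - `|s|))); last first.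
  rewrite ler_wpM2l ?expR_ge0//.
  apply: (tilted_int_unit_ge s (indic_ge0_le1 _) (measurable_indic_itv 0 1)) => t t01.
  by rewrite indic_itvE t01.
rewrite -expRD.
have gm1 l : gauss_mass (s + l) = gauss_mass s * expR (l ^+ 2 / 4 + s * l / 2).
  by rewrite /gauss_mass -[RHS]mulrA -expRD; congr (_ * expR _); field.
have gm0 := gauss_mass_gt0 s.
pose E1 := expR (1 ^+ 2 / 4 + s * 1 / 2); pose E2 := expR ((-1) ^+ 2 / 4 + s * -1 / 2).
rewrite -/K (_ : - _ / _ = - (K + 6 * (E1 + E2))); last first.
  by rewrite !gm1 -/E1 -/E2; field; rewrite gt_eqF.
apply: (@le_trans _ _ (expR (Num.sqrt pi + s ^+ 2 / 4) * expR (- (K + 6 * expR (`|s| / 2))))).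
  apply: ler_pM; [exact: ltW|exact: expR_ge0|exact: gauss_mass_le|].
  rewrite ler_expR lerN2 lerD2l ler_pM2l//.
  have : `|s| / 2 <= 1 ^+ 2 / 4 + s * 1 / 2 \/ `|s| / 2 <= (-1) ^+ 2 / 4 + s * -1 / 2.
    by have [s0|s0] := leP 0 s; [left; rewrite ger0_norm|right; rewrite ltr0_norm]; lra.
  by case => H; [rewrite -[leLHS]addr0|rewrite -[leLHS]add0r]; rewrite lerD ?ler_expR ?expR_ge0.
(* With [y = |s| / 2] what remains is [y^2 + 2 y <= 6 e^y], and [6 = 4 + 2] from [y^2 <= 4 e^y] and
   [1 + y <= e^y]. *)
rewrite -expRD ler_expR /K.
have y0 : 0 <= `|s| / 2 by rewrite divr_ge0.
have := sqr_le_expR y0; have := expR_ge1Dx (`|s| / 2).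
have -> : s ^+ 2 = `|s| ^+ 2 by rewrite real_normK ?num_real.
move: (expR _) => E; move: `|s| y0 => r y0; lra.
Qed.

End one_site.

(** * Wall and well under a tilted Gaussian *)

Section wall.
Variable R : realType.
Notation mu := (@lebesgue_measure R).
Variables a beta : R.
Hypothesis a0 : 0 < a.
Hypothesis b0 : 0 < beta.
Implicit Types s t : R.

Definition well t : R := \1_(`[0, a]%classic) t.
(** For [beta = e^b - 1] this is the factor [e^(b 1_[0, a])] on the half-line, in a form linear in
    [well]. *)
Definition wall t : R := \1_(`[0, +oo[%classic) t * (1 + beta * well t).
Let neg t : R := \1_(`]-oo, 0[%classic) t.

Lemma wellE t : well t = ((0 <= t <= a)%R)%:R.
Proof. exact: indic_itvE. Qed.

Lemma wallE t : wall t = ((0 <= t)%R)%:R * (1 + beta * well t).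
Proof.
rewrite /wall indicE; congr ((nat_of_bool _)%:R * _).
by apply/idP/idP; rewrite inE/= in_itv/= andbT.
Qed.

Let negE t : neg t = ((t < 0)%R)%:R.
Proof. by rewrite /neg indicE; congr (nat_of_bool _)%:R; apply/idP/idP; rewrite inE/= in_itv. Qed.

Lemma measurable_well : measurable_fun setT well.
Proof. exact: measurable_indic. Qed.

Lemma measurable_wall : measurable_fun setT wall.
Proof.
apply: measurable_funM; first exact: measurable_indic.
by apply: measurable_funD => //; apply: measurable_funM => //; exact: measurable_well.
Qed.

Let measurable_neg : measurable_fun setT neg.
Proof. exact: measurable_indic. Qed.

Lemma well_ge0_le1 t : 0 <= well t <= 1. Proof. exact: indic_ge0_le1. Qed.

Lemma wall_bounds t : 0 <= wall t <= 1 + beta.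
Proof.
rewrite wallE; have /andP[w0 w1] := well_ge0_le1 t.
move: (well t) w0 w1 => w w0 w1.
have bw : 0 <= beta * w by rewrite mulr_ge0// ltW.
have bw1 : beta * w <= beta by rewrite ler_piMr// ltW.
case: (0 <= t); rewrite /= ?mulr1n ?mulr0n ?mul1r ?mul0r; apply/andP; split; lra.
Qed.

Lemma wall_neg s : tilted_int wall s + tilted_int neg s = gauss_mass s + beta * tilted_int well s.
Proof.
have mt := measurable_tilt s.
have e0 t : 0 <= expR (- t ^+ 2 + s * t) by exact: expR_ge0.
have p1 t : 0 <= wall t * expR (- t ^+ 2 + s * t).
  by rewrite mulr_ge0//; have /andP[] := wall_bounds t.
have p2 t : 0 <= neg t * expR (- t ^+ 2 + s * t).
  by rewrite mulr_ge0//; have /andP[] := indic_ge0_le1 `]-oo, 0[ t.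
have p3 t : 0 <= well t * expR (- t ^+ 2 + s * t).
  by rewrite mulr_ge0//; have /andP[] := well_ge0_le1 t.
have m1 := measurable_funM measurable_wall mt.
have m2 := measurable_funM measurable_neg mt.
have m3 := measurable_funM measurable_well mt.
have H1 := integralD_fin p1 p2 m1 m2 (tilted_intE s wall_bounds measurable_wall)
  (tilted_intE s (indic_ge0_le1 _) measurable_neg).
have H3 := integralZ_fin (ltW b0) p3 m3 (tilted_intE s well_ge0_le1 measurable_well).
have H2 := integralD_fin e0 (fun t => mulr_ge0 (ltW b0) (p3 t)) mt
  (measurable_funM (measurable_cst beta) m3) (integral_gauss_mass s) H3.
apply: EFin_inj; rewrite -H1 -H2; apply: eq_integral => t _; congr EFin.
rewrite wallE negE wellE; case: (leP 0 t) => t0 /=; ring.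
Qed.

(** The half-line is cut at [- e]: the integrand is at most 1 on [[- e, 0]], and [s t <= - e s]
    below. *)
Lemma tilted_int_neg_le s (e : R) : 0 <= s -> 0 < e ->
  tilted_int neg s <= e + expR (- (e * s)) * gauss_mass 0.
Proof.
move=> s0 e0.
have E := @integral_indic_itv R (- e) 0 _; rewrite sub0r opprK oppr_le0 in E.
have {}E := E (ltW e0).
have i0 t : 0 <= (\1_(`[- e, 0]%classic) t : R) by have /andP[] := indic_ge0_le1 `[- e, 0] t.
have x0 t : 0 <= expR (- t ^+ 2 + 0 * t) by exact: expR_ge0.
have mt0 := measurable_tilt (0 : R).
have H := integralD_fin i0 (fun t => mulr_ge0 (expR_ge0 (- (e * s))) (x0 t))
  (measurable_indic_itv _ _) (measurable_funM (measurable_cst _) mt0) E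
  (integralZ_fin (expR_ge0 _) x0 mt0 (integral_gauss_mass 0)).
rewrite -lee_fin -H -(tilted_intE s (indic_ge0_le1 _) measurable_neg); apply: le_integral_fin.
- by move=> t; rewrite mulr_ge0 ?expR_ge0//; have /andP[] := indic_ge0_le1 `]-oo, 0[ t.
- move=> t; rewrite -/(neg t) negE; case: ltP => t0; last first.
    by rewrite mul0r addr_ge0// mulr_ge0 ?expR_ge0.
  rewrite /= mul1r; have [et|et] := leP (- e) t.
    rewrite indic_itvE et (ltW t0) /= -[leLHS]addr0 lerD ?mulr_ge0 ?expR_ge0//.
    by rewrite -expR0 ler_expR; nra.
  apply: ler_wpDl => //; rewrite -expRD ler_expR; nra.
- by apply: measurable_funM => //; exact: measurable_tilt.
- apply: measurable_funD; first exact: measurable_indic.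
  by apply: measurable_funM => //; exact: measurable_tilt.
Qed.

Lemma tilted_int_well_ge s : a <= s -> a <= tilted_int well s.
Proof.
move=> as_.
have E := @integral_indic_itv R 0 a (ltW a0); rewrite subr0 in E.
rewrite -lee_fin -E -(tilted_intE s well_ge0_le1 measurable_well); apply: le_integral_fin.
- by move=> t; have /andP[] := well_ge0_le1 t.
- move=> t; rewrite -/(well t) wellE; case: (boolP (0 <= t <= a)) => [/andP[t0 ta]|_].
    by rewrite /= mul1r -expR0 ler_expR; nra.
  by rewrite /= mul0r.
- exact: measurable_indic.
- by apply: measurable_funM; [exact: measurable_well|exact: measurable_tilt].
Qed.

(* If the tilt [s] is large, the well outweighs the wall: the mass of the
   half-line is at most half of [beta] times the mass of the well. If it is not,
   the doubly exponential term makes the left-hand side negligible. *)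
Lemma wall_site : exists s0 c C : R, [/\ 0 < s0, 0 < c, 0 < C &
  forall s lam, 1 <= lam ->
    gauss_mass s * expR (c * tilted_int well s / gauss_mass s - C * expR (lam * ((s0 - s) / 2)))
    <= tilted_int wall s].
Proof.
(* Each of the two terms of [tilted_int_neg_le] will be at most [e], so the lost mass is at most
   [beta * a / 2], half of [beta] times a lower bound for the mass of the well. *)
pose e := beta * a / 4; have e0 : 0 < e by rewrite divr_gt0// mulr_gt0.
have sp : 0 < Num.sqrt (pi : R) by rewrite sqrtr_gt0 pi_gt0.
(* The first term secures [tilted_int_well_ge], the second [sqrt pi * e^(- e s) <= e]. *)
pose s0 := a + Num.sqrt pi / e ^+ 2.
have q0 : 0 < Num.sqrt pi / e ^+ 2 by rewrite divr_gt0// exprn_gt0.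
have s00 : 0 < s0 by rewrite addr_gt0.
(* Solves [c * (1 + beta / 2) = beta / 2], which gives [1 <= (1 - c p) (1 + p beta / 2)] on [[0, 1]]
   and hence [e^(c p) <= 1 + p beta / 2]. *)
pose c := (beta / 2) / (1 + beta / 2).
have b2 : 0 < beta / 2 by rewrite divr_gt0.
have c0 : 0 < c by rewrite divr_gt0// addr_gt0.
(* Below [s0], with [y = (s0 - s) / 2], one has [s^2 / 4 + |s| <= s0^2 / 2 + s0 + 2 y^2 + 2 y]; the
   summand 10 pays for the part in [y], which is at most [10 e^y]. *)
pose C := Num.sqrt pi + c + 1 + s0 + s0 ^+ 2 / 2 + 10.
have C0 : 0 < C by rewrite /C; have := sqr_ge0 s0; lra.
exists s0, c, C; split => // s lam lam1.
have gm0 := gauss_mass_gt0 s.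
have w0 : 0 <= tilted_int well s.
  rewrite -lee_fin -(tilted_intE s well_ge0_le1 measurable_well); apply: integral_ge0 => t _.
  by rewrite lee_fin mulr_ge0 ?expR_ge0//; have /andP[] := well_ge0_le1 t.
have w1 : tilted_int well s / gauss_mass s <= 1.
  by rewrite ler_pdivrMr// (tilted_int_le s well_ge0_le1 measurable_well).
have p0 : 0 <= tilted_int well s / gauss_mass s by rewrite divr_ge0// ltW.
rewrite -mulrA.
have [ss|ss] := leP s0 s.
  have ge : gauss_mass s + beta / 2 * tilted_int well s <= tilted_int wall s.
    have : tilted_int neg s <= e + e.
      apply: (le_trans (tilted_int_neg_le _ e0)); first exact: le_trans (ltW s00) ss.
      rewrite lerD2l /gauss_mass expr0n mul0r expR0 mulr1 expRN mulrC.
      rewrite ler_pdivrMr ?expR_gt0//.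
      have sq : Num.sqrt pi <= e * (e * s).
        have : Num.sqrt pi / e ^+ 2 <= s.
          by apply: le_trans ss; rewrite /s0 lerDr ltW.
        by rewrite ler_pdivrMr ?exprn_gt0// => H; apply: (le_trans H); rewrite expr2 mulrC mulrA.
      apply: (le_trans sq); rewrite ler_pM2l//.
      by apply: le_trans (expR_ge1Dx _); rewrite lerDr.
    have aJ : a <= tilted_int well s.
      by apply: tilted_int_well_ge; apply: le_trans ss; rewrite /s0 lerDl ltW.
    have : beta * a <= beta * tilted_int well s by rewrite ler_pM2l.
    have := wall_neg s; rewrite /e; lra.
  apply: le_trans ge.
  rewrite [leRHS](_ : _ = gauss_mass s * (1 + beta / 2 * (tilted_int well s / gauss_mass s))); last first.
    by field; rewrite gt_eqF.
  rewrite ler_pM2l//; move: (_ / gauss_mass s) p0 w1 => p p0 p1.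
  apply: (@le_trans _ _ (expR (c * p))).
    by rewrite ler_expR gerDl oppr_le0 mulr_ge0 ?expR_ge0// ltW.
  have cE : c * (1 + beta / 2) = beta / 2 by rewrite divfK// gt_eqF// addr_gt0.
  have c1 : c < 1 by nra.
  have z1 : 0 < 1 - c * p by nra.
  rewrite -(ler_pM2r z1); apply: (@le_trans _ _ 1).
    rewrite -[X in _ <= X](expRxMexpNx_1 (c * p)) ler_pM2l ?expR_gt0//.
    exact: expR_ge1Dx.
  have : c * p * (beta / 2 * p) <= c * p * (beta / 2).
    apply: ler_wpM2l; first by rewrite mulr_ge0// ltW.
    by rewrite ler_piMr// ltW.
  nra.
have unit_ge : expR (- 1 - `|s|) <= tilted_int wall s.
  apply: (tilted_int_unit_ge s wall_bounds measurable_wall) => t /andP[t0 t1].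
  have /andP[w0' _] := well_ge0_le1 t.
  by rewrite wallE t0 mul1r lerDl mulr_ge0// ltW.
apply: le_trans unit_ge.
pose y := (s0 - s) / 2; have y0 : 0 <= y by rewrite divr_ge0// subr_ge0 ltW.
have E1 := expR_ge1Dx y; have E2 := sqr_le_expR y0.
have El : expR y <= expR (lam * y) by rewrite ler_expR ler_peMl.
apply: (@le_trans _ _ (expR (Num.sqrt pi + s ^+ 2 / 4) * expR (c - C * expR y))).
  apply: ler_pM; [exact: ltW|exact: expR_ge0|exact: gauss_mass_le|].
  rewrite ler_expR lerD//; first by rewrite ler_piMr// ltW.
  by rewrite lerN2 ler_pM2l.
rewrite -expRD ler_expR.
have sE : s = s0 - 2 * y by rewrite /y; field.
have ns : `|s| <= s0 + 2 * y.
  by rewrite sE; apply: (le_trans (ler_normB _ _)); rewrite (ger0_norm (ltW s00)) ger0_norm// mulr_ge0.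
have CE : (C - 10) * 1 <= (C - 10) * expR y.
  by rewrite ler_wpM2l//; [rewrite /C; have := sqr_ge0 s0; lra|lra].
have s2 : s ^+ 2 <= 2 * s0 ^+ 2 + 8 * y ^+ 2.
  by rewrite sE; have := sqr_ge0 (s0 + 2 * y); nra.
have CE' : C * expR y = (C - 10) * expR y + 10 * expR y by ring.
rewrite CE'; move: CE; rewrite /C; move: (expR y) E1 E2 => E E1 E2 CE.
lra.
Qed.

(** The loss [C e^(lam (s0 - s') / 2)] at the raised tilt [s' = s + 2 h] has to be a Gaussian
    average: under tilt [s], [e^(- lam t)] averages to [e^(lam^2 / 4 - lam s / 2)], whence the
    constant in front. [lam] stays free, to be adapted to the variance of the marginal. *)
Lemma interior_triple : exists s0 c C : R, [/\ 0 < s0, 0 < c, 0 < C &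
  forall h lam, 1 <= lam ->
    site_triple (fun t => wall (t + h)) (fun t => c * well (t + h))
     (fun t => C * expR (lam * (s0 / 2 - h) - lam ^+ 2 / 4) * expR (- lam * t))].
Proof.
have [s0 [c [C [s00 c0 C0 H]]]] := wall_site.
exists s0, c, C; split => // h lam lam1.
set A := C * _; have A0 : 0 < A by rewrite mulr_gt0 ?expR_gt0.
have msh : measurable_fun setT (fun t : R => t + h) by exact: measurable_shift.
have mwall : measurable_fun setT (fun t => wall (t + h)).
  by apply: measurableT_comp => //; exact: measurable_wall.
have mwell : measurable_fun setT (fun t => c * well (t + h)).
  by apply: measurable_funM => //; apply: measurableT_comp => //; exact: measurable_well.
have me : measurable_fun setT (fun t : R => expR (- lam * t)).
  by apply: measurableT_comp => //; exact: measurable_funM.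
have cw t : 0 <= c * well t <= c.
  by have /andP[? ?] := well_ge0_le1 t; rewrite mulr_ge0 ?(ltW c0)//= ler_piMr// ltW.
have mcw : measurable_fun setT (fun t => c * well t).
  by apply: measurable_funM => //; exact: measurable_well.
have rhoE s : (\int[mu]_t (A * expR (- lam * t) * expR (- t ^+ 2 + s * t))%:E =
    (A * gauss_mass (s - lam))%:E)%E.
  rewrite -(integralZ_fin (ltW A0) (fun t => expR_ge0 _) (measurable_tilt _)
    (integral_gauss_mass (s - lam))).
  apply: eq_integral => t _; rewrite -mulrA -expRD; congr (_ * expR _)%:E; ring.
split.
- move=> t; split.
  + by have /andP[] := wall_bounds (t + h).
  + by have /andP[] := cw (t + h).
  + by rewrite mulr_ge0 ?expR_ge0// ltW.
- by split => //; exact: measurable_funM.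
- move=> s; split.
  + exact: (tilted_intE s (fun t => wall_bounds (t + h))).
  + exact: (tilted_intE s (fun t => cw (t + h))).
  + by rewrite (tilted_int_eq (rhoE s)).
move=> s; rewrite (tilted_int_eq (rhoE s)) (tilted_int_shift s h wall_bounds measurable_wall).
rewrite (tilted_int_shift s h cw mcw).
have -> : tilted_int (fun t => c * well t) (s + 2 * h) = c * tilted_int well (s + 2 * h).
  apply: tilted_int_eq.
  rewrite -(integralZ_fin (ltW c0) _ _ (tilted_intE (s + 2 * h) well_ge0_le1 measurable_well)).
  - by apply: eq_integral => t _; rewrite mulrA.
  - by move=> t; rewrite mulr_ge0 ?expR_ge0//; have /andP[] := well_ge0_le1 t.
  - by apply: measurable_funM; [exact: measurable_well|exact: measurable_tilt].
have := H (s + 2 * h) lam lam1; rewrite gauss_mass_shift.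
have gm0 := gauss_mass_gt0 s; set q := h ^+ 2 + s * h.
rewrite -(ler_pM2l (expR_gt0 (- q))); apply: le_trans.
have gml : gauss_mass (s - lam) = gauss_mass s * expR (lam ^+ 2 / 4 - s * lam / 2).
  by rewrite /gauss_mass -[RHS]mulrA -expRD; congr (_ * expR _); field.
have E : expR q * expR (- q) = 1 := expRxMexpNx_1 q.
rewrite le_eqVlt; apply/orP; left; apply/eqP.
set X := expR (_ - C * _); have -> : expR (- q) * (gauss_mass s * expR q * X) =
    gauss_mass s * X by rewrite -[RHS]mul1r -E; ring.
rewrite /X; congr (_ * expR _); rewrite mulrBl; congr (_ - _).
  rewrite expRN; field; rewrite !gt_eqF ?expR_gt0//.
rewrite gml mulrCA [gauss_mass s * _]mulrC mulfK ?gt_eqF// /A -[LHS]mulrA -expRD.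
by congr (_ * expR _); field.
Qed.

End wall.

(** * Mean gain of a site under the free marginal *)

Section gain.
Variable R : realType.
Notation mu := (@lebesgue_measure R).
Implicit Types s t u : R.

Definition site_gain u (f : R -> R) (g : R) : Prop :=
  exists th rho thb rhob, [/\ site_triple f th rho,
    (\int[mu]_t (th t * expR (- t ^+ 2 / (2 * u)))%:E =
      (thb * Num.sqrt (2 * pi * u))%:E)%E,
    (\int[mu]_t (rho t * expR (- t ^+ 2 / (2 * u)))%:E =
      (rhob * Num.sqrt (2 * pi * u))%:E)%E &
    g <= thb - rhob].

Lemma integral_exp_normal u l : 0 < u ->
  (\int[mu]_t (expR (l * t) * expR (- t ^+ 2 / (2 * u)))%:E =
   (Num.sqrt (2 * pi * u) * expR (l ^+ 2 * u / 2))%:E)%E.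
Proof.
move=> u0; have k0 : 0 < (2 * u)^-1 by rewrite invr_gt0 mulr_gt0.
have un0 : u != 0 by rewrite gt_eqF.
have := integral_expquad l k0; rewrite invrK.
rewrite (_ : pi * (2 * u) = 2 * pi * u); last by ring.
rewrite (_ : l ^+ 2 / (4 / (2 * u)) = l ^+ 2 * u / 2); last by field.
move=> <-; apply: eq_integral => t _; rewrite -expRD; congr (expR _)%:E.
by field.
Qed.

Lemma integral_normal u : 0 < u ->
  (\int[mu]_t (expR (- t ^+ 2 / (2 * u)))%:E = (Num.sqrt (2 * pi * u))%:E)%E.
Proof.
move=> u0; have := integral_exp_normal 0 u0.
rewrite expr0n !mul0r expR0 mulr1 => <-; apply: eq_integral => t _.
by rewrite mul0r expR0 mul1r.
Qed.

Lemma measurable_normal u :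
  measurable_fun setT (fun t : R => expR (- t ^+ 2 / (2 * u))).
Proof.
apply: measurableT_comp => //; apply: measurable_funM => //.
by apply: measurableT_comp => //; exact: measurable_funX.
Qed.

Lemma sqrt_2pi_gt0 u : 0 < u -> 0 < Num.sqrt (2 * pi * u).
Proof. by move=> u0; rewrite sqrtr_gt0 !mulr_gt0// pi_gt0. Qed.

Lemma boundary_gain (G h : R) : 0 <= h -> exists2 K, 0 <= K &
  forall u, 1 <= u <= G ->
    site_gain u (fun t => \1_(`[0, 1]%classic) t * expR (- h)) (- K).
Proof.
move=> h0; pose K0 := h + 1 + Num.sqrt (pi : R).
have K00 : 0 <= K0 by rewrite !addr_ge0// sqrtr_ge0.
exists (K0 + 12 * expR (G / 2)); first by rewrite addr_ge0// mulr_ge0// expR_ge0.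
move=> u /andP[u1 uG]; have u0 : 0 < u by exact: lt_le_trans u1.
have q0 := sqrt_2pi_gt0 u0.
exists (fun=> 0), (fun t => K0 + 6 * (expR t + expR (- t))), 0,
  (K0 + 12 * expR (u / 2)).
split; first exact: boundary_triple.
- by under eq_integral do rewrite mul0r; rewrite integral0 mul0r.
- have w0 t : 0 <= expR (- t ^+ 2 / (2 * u)) by exact: expR_ge0.
  have me l : measurable_fun setT (fun t : R => expR (l * t)).
    by apply: measurableT_comp => //; exact: measurable_funM.
  have mw := measurable_normal u.
  have m1 := measurable_funM (me 1) mw; have m2 := measurable_funM (me (-1)) mw.
  have e1 t : 0 <= expR (1 * t) * expR (- t ^+ 2 / (2 * u)) by rewrite mulr_ge0.
  have e2 t : 0 <= expR (-1 * t) * expR (- t ^+ 2 / (2 * u)) by rewrite mulr_ge0 ?expR_ge0.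
  have H12 := integralD_fin e1 e2 m1 m2 (integral_exp_normal 1 u0)
    (integral_exp_normal (-1) u0).
  have m12 := measurable_funD m1 m2.
  have H6 := integralZ_fin (ler0n R 6) (fun t => addr_ge0 (e1 t) (e2 t)) m12 H12.
  have HK := integralZ_fin K00 w0 mw (integral_normal u0).
  have H := integralD_fin (fun t => mulr_ge0 K00 (w0 t))
    (fun t => mulr_ge0 (ler0n R 6) (addr_ge0 (e1 t) (e2 t)))
    (measurable_funM (measurable_cst K0) mw)
    (measurable_funM (measurable_cst (6 : R)) m12) HK H6.
  transitivity ((K0 * Num.sqrt (2 * pi * u) +
    6 * (Num.sqrt (2 * pi * u) * expR (1 ^+ 2 * u / 2) +
         Num.sqrt (2 * pi * u) * expR ((-1) ^+ 2 * u / 2)))%:E)%E.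
    rewrite -H; apply: eq_integral => t _; rewrite mul1r mulN1r; congr EFin; ring.
  by rewrite sqrrN expr1n mul1r; congr EFin; ring.
- rewrite sub0r lerN2 lerD2l ler_pM2l// ler_expR ler_pM2r//.
Qed.

(** With [lam = h / u] the mean loss under [N(0, u)] is [C e^(- h^2 / (2 u)) e^(lam (s0 / 2 - lam /
    4))], while the mean gain is at least the same Gaussian factor times a constant. The last factor
    of the loss vanishes as [h] grows; its [- lam^2 / 4] comes from the conditional variance 1/2,
    which the conditional mean does not share. *)
Lemma interior_gain (a beta G : R) : 0 < a -> 0 < beta -> 1 <= G ->
  exists h kappa, [/\ 0 <= h, 0 < kappa &
    forall u, 1 <= u <= G -> site_gain u (fun t => wall a beta (t + h)) kappa].
Proof.
move=> a0 b0 G1; have [s0 [c [C [s00 c0 C0 H]]]] := interior_triple a0 b0.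
have G0 : 0 < G by exact: lt_le_trans G1.
have qG := sqrt_2pi_gt0 G0.
(* [C * k1] is half the coefficient of the gain. The loss is brought below it by [X = 1 / k1], since
   [e^(- X) <= k1]. *)
pose k1 := c * a / (2 * C * Num.sqrt (2 * pi * G)).
have k10 : 0 < k1 by rewrite divr_gt0 ?mulr_gt0.
pose X := k1^-1; have X0 : 0 < X by rewrite invr_gt0.
(* The first term forces [lam / 4 >= s0 / 2 + X]; [a] keeps the shifted well [[- h, a - h]] in the
   half-line [t <= 0], where its farthest point is [- h]; [G] gives [lam >= 1]. *)
pose h := 4 * G * (s0 / 2 + X) + a + G.
have hG : 4 * G * (s0 / 2 + X) <= h by rewrite /h; lra.
have p4 : 0 <= 4 * G * (s0 / 2 + X).
  by rewrite !mulr_ge0 ?addr_ge0 ?divr_ge0// ltW.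
have ah : a <= h by rewrite /h; lra.
have Gh : G <= h by rewrite /h; lra.
have h0 : 0 <= h by lra.
pose kappa := expR (- h ^+ 2 / 2) * (c * a / (2 * Num.sqrt (2 * pi * G))).
exists h, kappa; split => //.
  by rewrite mulr_gt0 ?expR_gt0// divr_gt0 ?mulr_gt0.
move=> u /andP[u1 uG]; have u0 : 0 < u by exact: lt_le_trans u1.
have un0 : u != 0 by rewrite gt_eqF.
have qu := sqrt_2pi_gt0 u0.
pose lam := h / u.
have lam1 : 1 <= lam by rewrite ler_pdivlMr// mul1r (le_trans uG).
pose A := C * expR (lam * (s0 / 2 - h) - lam ^+ 2 / 4).
have A0 : 0 < A by rewrite mulr_gt0 ?expR_gt0.
pose th t := c * well a (t + h).
have thM t : 0 <= th t <= c.
  by have /andP[? ?] := well_ge0_le1 a (t + h); rewrite mulr_ge0 ?(ltW c0)//= ler_piMr// ltW.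
have mth : measurable_fun setT th.
  apply: measurable_funM => //; apply: measurableT_comp; first exact: measurable_well.
  exact: measurable_shift.
have w0 t : 0 <= expR (- t ^+ 2 / (2 * u)) by exact: expR_ge0.
have mw := measurable_normal u.
have [thE _] := integral_bounded w0 mw (integral_normal u0) thM mth.
set Th := fine _ in thE.
have ThL : c * a * expR (- h ^+ 2 / (2 * u)) <= Th.
  rewrite -lee_fin -thE.
  have E : (\int[mu]_t (\1_(`[- h, a - h]%classic) t : R)%:E = a%:E)%E.
    by rewrite integral_indic_itv ?opprK ?subrK// -lerBlDr; lra.
  have ce0 : 0 <= c * expR (- h ^+ 2 / (2 * u)) by rewrite mulr_ge0 ?expR_ge0// ltW.
  rewrite mulrAC -(integralZ_fin ce0 _ (measurable_indic_itv _ _) E); last first.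
    by move=> t; have /andP[] := indic_ge0_le1 `[- h, a - h] t.
  apply: le_integral_fin.
  - by move=> t; rewrite mulr_ge0//; have /andP[] := indic_ge0_le1 `[- h, a - h] t.
  - move=> t; rewrite indic_itvE /th wellE.
    have -> : (0 <= t + h <= a) = (- h <= t <= a - h) by rewrite -lerBlDr sub0r -lerBrDr.
    case: (boolP (- h <= t <= a - h)) => [/andP[t1 t2]|_]; rewrite /= ?mulr0 ?mul0r//.
    rewrite !mulr1 ler_pM2l// ler_expR ler_pM2r ?invr_gt0 ?mulr_gt0// lerN2.
    nra.
  - by apply: measurable_funM => //; exact: measurable_indic.
  - exact: measurable_funM.
exists th, (fun t => A * expR (- lam * t)), (Th / Num.sqrt (2 * pi * u)),
  (A * expR (lam ^+ 2 * u / 2)).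
split; first exact: H.
- by rewrite thE divfK// gt_eqF.
- have me : measurable_fun setT (fun t : R => expR (- lam * t)).
    by apply: measurableT_comp => //; exact: measurable_funM.
  have E := integralZ_fin (ltW A0) (fun t => mulr_ge0 (expR_ge0 (- lam * t)) (w0 t))
    (measurable_funM me mw) (integral_exp_normal (- lam) u0).
  under eq_integral do rewrite -mulrA.
  by rewrite E sqrrN; congr EFin; ring.
pose g := expR (- h ^+ 2 / (2 * u)).
have g0 : 0 < g by exact: expR_gt0.
have sqG : Num.sqrt (2 * pi * u) <= Num.sqrt (2 * pi * G).
  by rewrite ler_wsqrtr// ler_pM2l// mulr_gt0// pi_gt0.
have T1 : g * (c * a / Num.sqrt (2 * pi * G)) <= Th / Num.sqrt (2 * pi * u).
  apply: (@le_trans _ _ (c * a * g / Num.sqrt (2 * pi * u))); last first.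
    by rewrite ler_pM2r ?invr_gt0.
  rewrite mulrA [g * _]mulrC ler_pM2l ?mulr_gt0//.
  by rewrite lef_pV2 ?posrE.
have T2 : A * expR (lam ^+ 2 * u / 2) <= g * (C * k1).
  rewrite /A -mulrA -expRD.
  have -> : lam * (s0 / 2 - h) - lam ^+ 2 / 4 + lam ^+ 2 * u / 2 =
     - h ^+ 2 / (2 * u) + lam * (s0 / 2 - lam / 4) by rewrite /lam; field.
  rewrite expRD -/g mulrCA ler_pM2l// ler_pM2l//.
  apply: (@le_trans _ _ (expR (- X))).
    rewrite ler_expR.
    have : s0 / 2 + X <= lam / 4.
      rewrite ler_pdivlMr// /lam ler_pdivlMr//; apply: le_trans hG.
      have sX : 0 < s0 / 2 + X by rewrite addr_gt0// divr_gt0.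
      have : (s0 / 2 + X) * u <= (s0 / 2 + X) * G by rewrite ler_pM2l.
      lra.
    by nra.
  rewrite expRN /X invf_ple ?posrE ?expR_gt0//.
  by apply: le_trans (expR_ge1Dx _); rewrite lerDr.
have gk : expR (- h ^+ 2 / 2) <= g.
  rewrite ler_expR !mulNr lerN2 ler_pM2l ?exprn_gt0//; last lra.
  by rewrite lef_pV2 ?posrE ?mulr_gt0// ler_peMr.
have CK : C * k1 = c * a / Num.sqrt (2 * pi * G) / 2.
  by rewrite /k1; field; rewrite !gt_eqF.
set Q := c * a / Num.sqrt (2 * pi * G) in T1 CK.
have Q0 : 0 < Q by rewrite divr_gt0// mulr_gt0.
have -> : kappa = expR (- h ^+ 2 / 2) * (Q / 2).
  by rewrite /kappa /Q; congr (_ * _); field; rewrite gt_eqF.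
apply: (@le_trans _ _ (g * (Q / 2))); first by rewrite ler_pM2r// divr_gt0.
move: T2; rewrite CK; lra.
Qed.

End gain.

(** * Product of the site factors under the free field *)

Section gain_product.
Variables (R : realType) (d N : nat).
Notation site := (site d).
Notation field := (field R d).
Hypothesis d3 : (3 <= d)%N.
Variables (f : site -> R -> R) (g : site -> R).
Hypothesis fg : forall x u, 1 <= u <= 16 * d%:R -> site_gain u (f x) (g x).

Lemma iint_prod_gain T : 0 <= T -> T <= \sum_(x <- Lam d N) g x ->
  ((zfree R d N * expR T)%:E <= iint (Lam d N)
    (fun phi => ((\prod_(x <- Lam d N) f x (phi x)) * expR (- Ham N phi))%:E))%E.
Proof.
move=> T0 Tg.
have d1 : 1 <= d%:R :> R by rewrite ler1n (leq_trans _ d3).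
have data x : exists p : field * ((R -> R) * (R -> R)) * (R * R),
    site_triple (f x) p.1.2.1 p.1.2.2 /\ (x \in Lam d N ->
    [/\ supp N p.1.1, forall z, z \in Lam d N -> Qf p.1.1 z = (z == x)%:R,
     (\int[@lebesgue_measure R]_t (p.1.2.1 t * expR (- t ^+ 2 / (2 * p.1.1 x)))%:E =
      (p.2.1 * Num.sqrt (2 * pi * p.1.1 x))%:E)%E,
     (\int[@lebesgue_measure R]_t (p.1.2.2 t * expR (- t ^+ 2 / (2 * p.1.1 x)))%:E =
      (p.2.2 * Num.sqrt (2 * pi * p.1.1 x))%:E)%E &
      g x <= p.2.1 - p.2.2]).
  have [xL|xL] := boolP (x \in Lam d N).
    have [u [su uQ]] := green_exists R d3 xL.
    have [u1 uG _] := green_bounds d3 xL su uQ.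
    have [|th [rho [thb [rhob [St Eth Erho gx]]]]] := @fg x (u x); first by rewrite u1.
    by exists (u, (th, rho), (thb, rhob)).
  (* Off the box only the triple itself is asked for, and any admissible variance provides it. *)
  have [|th [rho [thb [rhob [St _ _ _]]]]] := @fg x 1; first by rewrite lexx; lra.
  by exists (0, (th, rho), (thb, rhob)).
have [p pP] := choice data.
have pt x := (pP x).1; have pL x := (pP x).2.
apply: (@iint_prod_ge R d N d3 f (fun x => (p x).1.2.1) (fun x => (p x).1.2.2)
  (fun x => tilted_int (f x)) (fun x => tilted_int (p x).1.2.1) (fun x => tilted_int (p x).1.2.2)
  (fun x => (p x).1.1) (fun x => (p x).2.1) (fun x => (p x).2.2)) => //.
- by move=> x t; have [/(_ t)[]] := pt x.
- by move=> x t; have [/(_ t)[]] := pt x.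
- by move=> x t; have [/(_ t)[]] := pt x.
- by move=> x; have [_ []] := pt x.
- by move=> x; have [_ []] := pt x.
- by move=> x; have [_ []] := pt x.
- by move=> x s _; have [_ _ /(_ s)[]] := pt x.
- by move=> x s _; have [_ _ /(_ s)[]] := pt x.
- by move=> x s _; have [_ _ /(_ s)[]] := pt x.
- by move=> x s _; have [_ _ _] := pt x.
- by move=> x /pL[].
- by move=> x /pL[].
- by move=> x /pL[].
- by move=> x /pL[].
apply: (le_trans Tg); rewrite big_seq [leRHS]big_seq; apply: ler_sum => x.
by move=> /pL[].
Qed.

End gain_product.

(** * Partition functions *)

Section counting.
Variables (R : realType) (d : nat).

Definition interior N (x : site d) : bool := [forall p, nbr x p \in Lam d N].

Definition nbdry N : nat := count (predC (interior N)) (Lam d N).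

Lemma bernoulli_ineq (x : R) n : 0 <= x <= 1 -> 1 - n%:R * x <= (1 - x) ^+ n.
Proof.
move=> /andP[x0 x1]; elim: n => [|n IH]; first by rewrite mul0r subr0 expr0.
rewrite exprS; apply: (@le_trans _ _ ((1 - x) * (1 - n%:R * x))); last first.
  by rewrite ler_wpM2l// subr_ge0.
rewrite -natr1; have : 0 <= n%:R * (x * x) by rewrite !mulr_ge0.
lra.
Qed.

Lemma interior_box N x : (0 < N./2)%N -> x \in box d N./2.-1 -> interior N x.
Proof.
move=> m0; rewrite mem_box => /forallP H; apply/forallP => p.
rewrite mem_box; apply/forallP => i; apply: (le_trans (norm_nbr_le x p i)).
by have := H i; move: `|x i| => v; lia.
Qed.

Lemma count_interior_ge N : (0 < N./2)%N ->
  ((N./2).-1.*2.+1 ^ d <= count (interior N) (Lam d N))%N.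
Proof.
move=> m0; rewrite -size_box -size_filter; apply: uniq_leq_size.
  exact: uniq_box.
move=> x xB; rewrite mem_filter (interior_box m0 xB) /=.
move: xB; rewrite !mem_box => /forallP H; apply/forallP => i.
by apply: (le_trans (H i)); lia.
Qed.

(** For side length [v] the proportion of interior sites is at least [(1 - 2 / v)^d], and
    Bernoulli's inequality bounds the rest by [2 d / v]. *)
Lemma nbdry_small (del : R) : 0 < del -> exists N0, forall N, (N0 <= N)%N ->
  (nbdry N)%:R <= del * (size (Lam d N))%:R.
Proof.
move=> del0; pose y := 2 * d%:R / del.
have y0 : 0 <= y by rewrite divr_ge0 ?mulr_ge0// ltW.
exists (Num.bound y).+2 => N NN.
have m0 : (0 < N./2)%N by rewrite half_gt0; lia.
pose m := N./2; pose v : R := (m.*2.+1)%:R.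
have vN : (N <= m.*2.+1)%N by rewrite /m -{1}(odd_double_half N); case: (odd N); lia.
have yv : y <= v.
  apply: (le_trans (ltW (archi_boundP y0))); rewrite ler_nat; lia.
have v2 : 2 <= v by rewrite /v ler_nat /m; lia.
have v0 : 0 < v by lra.
have nE : (nbdry N)%:R = (size (Lam d N))%:R - (count (interior N) (Lam d N))%:R :> R.
  by rewrite -(count_predC (interior N)) natrD addrAC subrr add0r.
have sE : (size (Lam d N))%:R = v ^+ d :> R by rewrite size_box natrX.
have iL : (v - 2) ^+ d <= (count (interior N) (Lam d N))%:R :> R.
  apply: (@le_trans _ _ ((N./2).-1.*2.+1 ^ d)%:R); last by rewrite ler_nat count_interior_ge.
  rewrite natrX (_ : v - 2 = ((N./2).-1.*2.+1)%:R)//.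
  apply/eqP; rewrite subr_eq -natrD; apply/eqP; congr _%:R.
  by rewrite /m; lia.
have B : 1 - d%:R * (2 / v) <= (1 - 2 / v) ^+ d.
  apply: bernoulli_ineq; rewrite divr_ge0 ?(ltW v0)//= ler_pdivrMr// mul1r.
  exact: v2.
have vd0 : 0 < v ^+ d by rewrite exprn_gt0.
have : v ^+ d * (1 - d%:R * (2 / v)) <= (v - 2) ^+ d.
  rewrite (_ : v - 2 = v * (1 - 2 / v)); last by field; rewrite gt_eqF.
  by rewrite exprMn ler_pM2l.
have dv : d%:R * (2 / v) <= del.
  rewrite mulrA ler_pdivrMr// -ler_pdivrMl// mulrC [d%:R * 2]mulrC; exact: yv.
have := ler_wpM2l (ltW vd0) dv.
rewrite nE sE; move: iL; set c := _%:R.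
move: ((v - 2) ^+ d) (v ^+ d) (d%:R * (2 / v)) => V' V z; lra.
Qed.

Lemma expn_le_size_Lam N : N%:R ^+ d <= (size (Lam d N))%:R :> R.
Proof.
rewrite -natrX ler_nat size_box; elim: d => [|e IH]; first by rewrite !expn0.
rewrite !expnS leq_mul//.
by rewrite -{1}(odd_double_half N); case: (odd N); lia.
Qed.

End counting.

(** * Bounds on the masses with wall and pinning *)

Section partition_functions.
Variables (R : realType) (d N : nat) (a b : R).
Notation site := (site d).
Notation field := (field R d).
Notation L := (Lam d N).
Hypothesis d3 : (3 <= d)%N.
Hypothesis b0 : 0 < b.
Let d0 : (0 < d)%N. Proof. exact: leq_trans d3. Qed.
Let beta : R := expR b - 1.
Notation Om := (@OmegaPlus R d N).

Lemma xi_well (phi : field) : (xi N a phi)%:R = \sum_(x <- L) well a (phi x) :> R.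
Proof. by rewrite /xi natr_sum; apply: eq_bigr => x _; rewrite wellE. Qed.

Lemma xi_le_size (phi : field) : (xi N a phi)%:R <= (size L)%:R :> R.
Proof.
rewrite ler_nat /xi -sum1_size; apply: leq_sum => x _; exact: leq_b1.
Qed.

Lemma indic_OmegaPlus (phi : field) :
  \1_Om phi = \prod_(x <- L) \1_(`[0, +oo[%classic) (phi x) :> R.
Proof.
have pos t : (t \in (`[0, +oo[%classic : set R)) = (0 <= t).
  by apply/idP/idP; rewrite inE/= in_itv/= andbT.
have [OP|OP] := pselect (Om phi).
  rewrite indicE mem_set// big_seq big1// => x xL.
  by rewrite indicE pos OP.
have [x xL xneg] : exists2 x, x \in L & phi x < 0.
  apply/not_exists2P => H; apply: OP => x xL; rewrite leNgt; apply/negP => xn.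
  by have [//|//] := H x.
rewrite indicE memNset//= (bigD1_seq x) ?uniq_Lam//= indicE pos leNgt xneg /=.
by rewrite mul0r.
Qed.

Lemma wall_prod (phi : field) :
  (\1_Om phi : R) * expR (b * (xi N a phi)%:R) = \prod_(x <- L) wall a beta (phi x).
Proof.
rewrite xi_well mulr_sumr expR_sum indic_OmegaPlus -big_split.
apply: eq_bigr => x _; congr (_ * _); rewrite wellE.
case: (0 <= phi x <= a) => /=; first by rewrite !mulr1 /beta addrC subrK.
by rewrite !mulr0 expR0 addr0.
Qed.

Lemma rmeas_xi : rmeas (fun phi : field => (xi N a phi)%:R).
Proof.
have -> : (fun phi : field => (xi N a phi)%:R : R) =
    (fun phi => \sum_(x <- L) well a (phi x)) by apply/funext => phi; exact: xi_well.
exact: (rmeas_sum L (fun x => rmeas_coord x (measurable_well a))).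
Qed.

Lemma rmeas_weight : rmeas (fun phi : field => weight N a b phi).
Proof.
apply: rmeas_expR; apply: rmeasD; last exact: (rmeasM (rmeas_cst b) rmeas_xi).
by move=> d1 T1 u mu_; apply: measurableT_comp => //; exact: rmeas_Ham.
Qed.

Lemma rmeas_indicOm : rmeas (\1_Om : field -> R).
Proof.
have -> : (\1_Om : field -> R) =
    (fun phi => \prod_(x <- L) \1_(`[0, +oo[%classic) (phi x)).
  by apply/funext => phi; exact: indic_OmegaPlus.
have m : measurable_fun setT (\1_(`[0, +oo[%classic) : R -> R).
  exact: measurable_indic.
exact: (rmeas_prod L (fun x => rmeas_coord x m)).
Qed.

Lemma Zmass_ge0 (A : set field) : (0 <= Zmass N a b A)%E.
Proof.
by apply: iint_ge0 => phi; rewrite lee_fin mulr_ge0 ?expR_ge0// indicE.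
Qed.

Lemma Zmass_le (A : set field) (M : R) : rmeas (\1_A : field -> R) ->
  (forall phi, A phi -> (xi N a phi)%:R <= M) ->
  (Zmass N a b A <= (expR (b * M) * zfree R d N)%:E)%E.
Proof.
move=> mA AM; rewrite EFinM -ZfreeE// -iintZl ?expR_ge0//; last first.
  exact: (rmeas_fmeas (@rmeas_expHam R d N)).
apply: le_iint.
- by move=> phi; rewrite lee_fin mulr_ge0 ?expR_ge0// indicE.
- by move=> phi; rewrite -EFinM lee_fin mulr_ge0 ?expR_ge0.
- exact: (rmeas_fmeas (rmeasM mA rmeas_weight)).
- exact: (rmeas_fmeas (rmeasM (rmeas_cst _) (@rmeas_expHam R d N))).
move=> phi _; rewrite -EFinM lee_fin -expRD indicE.
have [Ap|Ap] := pselect (A phi).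
  rewrite mem_set// mul1r ler_expR addrC lerD2r ler_pM2l//; exact: AM.
by rewrite memNset// mul0r expR_ge0.
Qed.

Lemma Zmass_fin (A : set field) : rmeas (\1_A : field -> R) ->
  Zmass N a b A = (fine (Zmass N a b A))%:E.
Proof.
move=> mA; rewrite fineK// ge0_fin_numE ?Zmass_ge0//.
by apply: (le_lt_trans (Zmass_le mA (fun phi _ => xi_le_size phi))); rewrite ltry.
Qed.

Variables (h kappa K : R).
Hypothesis h0 : 0 <= h.
Hypothesis gI : forall u, 1 <= u <= 16 * d%:R ->
  site_gain u (fun t => wall a beta (t + h)) kappa.
Hypothesis gB : forall u, 1 <= u <= 16 * d%:R ->
  site_gain u (fun t => \1_(`[0, 1]%classic) t * expR (- h)) (- K).

Let w : field := fun z => if z \in L then h else 0.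

Let sw : supp N w. Proof. by move=> z /negPf zL; rewrite /w zL. Qed.

Lemma Qf_step_interior x : x \in L -> interior N x -> Qf w x = 0.
Proof.
move=> xL /forallP H; rewrite /Qf /w xL.
under eq_bigr do rewrite H.
rewrite sum_dir mulrA mulVf ?mul1r ?subrr// mulf_neq0// pnatr_eq0 -lt0n//.
Qed.

Lemma Qf_step_bounds x : x \in L -> 0 <= Qf w x <= h.
Proof.
move=> xL; have dR : 0 < 2 * d%:R :> R by rewrite mulr_gt0// ltr0n.
have w0 z : 0 <= w z by rewrite /w; case: ifP.
have wh z : w z <= h by rewrite /w; case: ifP.
rewrite /Qf {1 3}/w xL; apply/andP; split; last first.
  by rewrite gerBl mulr_ge0 ?invr_ge0 ?(ltW dR)// sumr_ge0.
rewrite subr_ge0 mulrC ler_pdivrMr// mulrC -sum_dir; exact: ler_sum.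
Qed.

Lemma Ham_step : Ham N w <= h ^+ 2 / 2 * (nbdry d N)%:R.
Proof.
have : 2 * Ham N w <= h ^+ 2 * (nbdry d N)%:R.
  rewrite Ham_Qf// (_ : h ^+ 2 * _ = \sum_(x <- L) if interior N x then 0 else h ^+ 2).
    rewrite big_seq [leRHS]big_seq; apply: ler_sum => x xL.
    case: ifPn => [xI|_]; first by rewrite Qf_step_interior// mulr0.
    rewrite /w xL expr2 ler_wpM2l//; by have /andP[] := Qf_step_bounds xL.
  rewrite /nbdry -sum1_count natr_sum mulr_sumr big_mkcond; apply: eq_bigr => x _ /=.
  by case: (interior N x) => //=; rewrite mulr1.
lra.
Qed.

Let f (x : site) : R -> R := if interior N x then (fun t => wall a beta (t + h))
  else (fun t => \1_(`[0, 1]%classic) t * expR (- h)).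
Let g (x : site) : R := if interior N x then kappa else - K.

Let beta0 : 0 < beta. Proof. by rewrite subr_gt0 -expR0 ltr_expR. Qed.

(** Translation by [w] leaves the linear term [phi x * Qf w x], which vanishes at interior sites. At
    boundary sites it is at most [h] on [[0, 1]]: hence the restriction of [f] to that interval and
    its factor [e^(- h)]. *)
Let f_le x t : x \in L -> f x t <= wall a beta (t + h) * expR (- (t * Qf w x)).
Proof.
move=> xL; rewrite /f; case: ifPn => xI.
  by rewrite Qf_step_interior// mulr0 oppr0 expR0 mulr1.
have /andP[W0 _] := wall_bounds a beta0 (t + h).
rewrite indic_itvE; case: (boolP (0 <= t <= 1)) => [/andP[t0 t1]|_] /=; last first.
  by rewrite mul0r mulr_ge0 ?expR_ge0.
apply: ler_pM; [by []|exact: expR_ge0| |].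
  have /andP[W1 _] := well_ge0_le1 a (t + h).
  have th0 : (0 <= t + h)%R by rewrite addr_ge0.
  by rewrite wallE th0 /= !mulr1n mul1r lerDl mulr_ge0// ltW.
have /andP[q0 qh] := Qf_step_bounds xL.
by rewrite ler_expR lerN2; apply: le_trans qh; rewrite ler_piMl.
Qed.

Let f_ge0 x t : 0 <= f x t.
Proof.
rewrite /f; case: ifP => _; first by have /andP[] := wall_bounds a beta0 (t + h).
by rewrite mulr_ge0 ?expR_ge0//; have /andP[] := indic_ge0_le1 `[0, 1] t.
Qed.

Let mf x : measurable_fun setT (f x).
Proof.
rewrite /f; case: ifP => _; last by apply: measurable_funM => //; exact: measurable_indic.
by apply: measurableT_comp; [exact: measurable_wall|exact: measurable_shift].
Qed.

(* Raising the whole box to height [h] costs only a surface term, after which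
   every interior site contributes a factor of at least [expR kappa]. *)
Lemma Zmass_OmegaPlus_ge :
  let T := kappa * (size L)%:R - (kappa + K) * (nbdry d N)%:R in
  0 <= T ->
  ((zfree R d N * expR (T - h ^+ 2 / 2 * (nbdry d N)%:R))%:E <= Zmass N a b Om)%E.
Proof.
move=> T T0.
have Tg : T <= \sum_(x <- L) g x.
  have -> : \sum_(x <- L) g x = \sum_(x <- L) (kappa - (kappa + K) * (~~ interior N x)%:R).
    by apply: eq_bigr => x _; rewrite /g; case: (interior N x); rewrite /= ?mulr0; ring.
  rewrite sumrB -mulr_sumr big_const_seq count_predT iter_addr_0 -mulr_natr.
  have -> : \sum_(x <- L) (~~ interior N x)%:R = (nbdry d N)%:R :> R.
    rewrite /nbdry -sum1_count natr_sum [RHS]big_mkcond; apply: eq_bigr => x _ /=.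
    by case: (interior N x).
  exact: lexx.
have fg x u : 1 <= u <= 16 * d%:R -> site_gain u (f x) (g x).
  by rewrite /f /g; case: ifP => _; [exact: gI|exact: gB].
have mI := rmeas_indicOm; have mW := rmeas_weight.
rewrite /Zmass (@iint_translate _ _ _ _ w); last 3 first.
- by move=> phi; rewrite lee_fin mulr_ge0 ?expR_ge0// indicE.
- exact: (rmeas_fmeas (rmeasM mI mW)).
- exact: sw.
rewrite expRD mulrA mulrC EFinM.
apply: (@le_trans _ _ ((expR (- Ham N w))%:E * iint L (fun phi =>
   ((\prod_(x <- L) f x (phi x)) * expR (- Ham N phi))%:E))%E).
  apply: lee_pmul.
  - by rewrite lee_fin expR_ge0.
  - by rewrite lee_fin mulr_ge0 ?expR_ge0// ltW// zfree_gt0.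
  - by rewrite lee_fin ler_expR lerN2 Ham_step.
  - exact: (iint_prod_gain d3 fg T0 Tg).
rewrite -iintZl ?expR_ge0//; last 2 first.
- by move=> phi; rewrite lee_fin mulr_ge0 ?prodr_ge0 ?expR_ge0.
- exact: (rmeas_fmeas (rmeasM (rmeas_prod L (fun x => rmeas_coord x (mf x)))
    (@rmeas_expHam R d N))).
have mtr (F : field -> R) : rmeas F -> rmeas (fun phi => F (phi + w)).
  move=> mF d1 T1 u mu_; apply: mF => z; exact: measurable_funD.
apply: le_iint.
- by move=> phi; rewrite -EFinM lee_fin !mulr_ge0 ?prodr_ge0 ?expR_ge0.
- by move=> phi; rewrite lee_fin mulr_ge0 ?expR_ge0// indicE.
- exact: (rmeas_fmeas (rmeasM (rmeas_cst _) (rmeasM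
    (rmeas_prod L (fun x => rmeas_coord x (mf x))) (@rmeas_expHam R d N)))).
- exact: (rmeas_fmeas (mtr _ (rmeasM mI mW))).
(* The shifted energy is the free energy, the energy of the plateau [w], and a linear term that
   [f_le] absorbs site by site. *)
move=> phi s0; rewrite -EFinM lee_fin /weight expRD [leRHS]mulrCA wall_prod HamD bform_Qf//.
have -> : - (Ham N phi + \sum_(x <- L) phi x * Qf w x + Ham N w) =
  - Ham N w + (- Ham N phi + - \sum_(x <- L) phi x * Qf w x) by ring.
rewrite !expRD -mulrA ler_pM2l ?expR_gt0// mulrC -mulrA ler_pM2l ?expR_gt0//.
rewrite -sumrN expR_sum mulrC -big_split /= big_seq [leRHS]big_seq.
apply: ler_prod => x xL; rewrite f_ge0 /= fctE.
by have := f_le (phi x) xL; rewrite {2}/w xL.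
Qed.

End partition_functions.

(** * The conditional probability *)

Lemma rmeas_indic_xi (R : realType) d N (a c : R) :
  rmeas (\1_[set phi | c < (xi N a phi)%:R] : field R d -> R).
Proof.
have -> : (\1_[set phi | c < (xi N a phi)%:R] : field R d -> R) =
    (fun phi => \1_(`]c, +oo[%classic) ((xi N a phi)%:R : R)).
  apply/funext => phi; rewrite !indicE; congr (nat_of_bool _)%:R.
  by apply/idP/idP; rewrite !inE /= in_itv/= andbT.
move=> d1 T1 u mu_; apply: measurableT_comp; first exact: measurable_indic.
exact: rmeas_xi.
Qed.

Lemma rmeas_indicC (R : realType) d (A : set (field R d)) :
  rmeas (\1_A : _ -> R) -> rmeas (\1_(~` A) : _ -> R).
Proof.
move=> mA; have -> : (\1_(~` A) : field R d -> R) = (fun phi => 1 + -1 * \1_A phi).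
  by apply/funext => phi; rewrite !indicE in_setC; case: (phi \in A) => /=; ring.
exact: (rmeasD (rmeas_cst 1) (rmeasM (rmeas_cst (-1)) mA)).
Qed.

Lemma rmeas_indicI (R : realType) d (A B : set (field R d)) :
  rmeas (\1_A : _ -> R) -> rmeas (\1_B : _ -> R) -> rmeas (\1_(A `&` B) : _ -> R).
Proof. by rewrite indicI; exact: rmeasM. Qed.

Lemma ZmassD (R : realType) d N (a b : R) (A B : set (field R d)) :
  rmeas (\1_A : _ -> R) -> rmeas (\1_B : _ -> R) ->
  (Zmass N a b B = Zmass N a b (A `&` B) + Zmass N a b (~` A `&` B))%E.
Proof.
move=> mA mB.
have pos (C : set (field R d)) phi : (0 <= (\1_C phi * weight N a b phi)%:E)%E.
  by rewrite lee_fin mulr_ge0 ?expR_ge0// indicE.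
have mW := @rmeas_weight R d N a b.
rewrite /Zmass -iintD//; last 2 first.
- exact: (rmeas_fmeas (rmeasM (rmeas_indicI mA mB) mW)).
- exact: (rmeas_fmeas (rmeasM (rmeas_indicI (rmeas_indicC mA) mB) mW)).
apply: eq_iint => phi; rewrite -EFinD -mulrDl; congr (_ * _)%:E.
by rewrite !indicE !in_setI in_setC; case: (phi \in A); case: (phi \in B) => /=; ring.
Qed.

Theorem mainTheorem2 (R : realType) (d : nat) (a b : R) :
  (3 <= d)%N -> 0 < a -> 0 < b ->
  exists eps : R, 0 < eps /\ exists eta : R, 0 < eta /\
  exists N0 : nat, forall N : nat, (N0 <= N)%N ->
    Pcond N a b [set phi : field R d | eps * (N%:R ^+ d) < (xi N a phi)%:R]
                (@OmegaPlus R d N)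
      >= 1 - expR (- (eta * N%:R ^+ d)).
Proof.
move=> d3 a0 b0.
have beta0 : 0 < expR b - 1 by rewrite subr_gt0 -expR0 ltr_expR.
have d1 : 1 <= d%:R :> R by rewrite ler1n (leq_trans _ d3).
have G1 : 1 <= 16 * d%:R :> R by lra.
have [h [kappa [h0 k0 gI]]] := interior_gain a0 beta0 G1.
have [K K0 gB] := boundary_gain (16 * d%:R) h0.
(* Total cost of a boundary site: the forgone [kappa], the loss [K], and its share of [Ham_step]. If
   the proportion of such sites is at most [kappa / (2 D)], half of the gain survives. *)
pose D := kappa + K + h ^+ 2 / 2.
have D0 : 0 < D by rewrite /D; have := sqr_ge0 h; lra.
have del0 : 0 < kappa / (2 * D) by rewrite divr_gt0// mulr_gt0.
have [N0 small] := nbdry_small d del0.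
(* On the complement the pinning is worth at most [e^(b eps N^d) = e^(kappa N^d / 4)], against
   [e^(kappa |Lam| / 2)] for all of [Om]; as [|Lam| >= N^d], this leaves [eta = kappa / 4]. *)
exists (kappa / (4 * b)); split; first by rewrite divr_gt0// mulr_gt0.
exists (kappa / 4); split; first by rewrite divr_gt0.
exists N0 => N /small nbr.
set A := [set phi | _]; set Om := @OmegaPlus R d N.
pose V : R := N%:R ^+ d; pose n : R := (size (Lam d N))%:R.
have V0 : 0 <= V by rewrite exprn_ge0.
have Vn : V <= n by exact: expn_le_size_Lam.
have Dnb : D * (nbdry d N)%:R <= kappa / 2 * n.
  rewrite (_ : kappa / 2 * n = D * (kappa / (2 * D) * n)); last first.
    by field; rewrite gt_eqF.
  by rewrite ler_pM2l.
have nb0 : 0 <= (nbdry d N)%:R :> R by [].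
have n0 : 0 <= n by exact: le_trans V0 Vn.
have kn : 0 <= kappa * n by rewrite mulr_ge0// ltW.
have hnb : 0 <= h ^+ 2 / 2 * (nbdry d N)%:R by rewrite mulr_ge0// divr_ge0// sqr_ge0.
have DE : D * (nbdry d N)%:R = (kappa + K) * (nbdry d N)%:R +
  h ^+ 2 / 2 * (nbdry d N)%:R by rewrite /D; ring.
have T0 : 0 <= kappa * n - (kappa + K) * (nbdry d N)%:R by lra.
have z0 := zfree_gt0 R N d3; set z := zfree R d N in z0.
have mA := @rmeas_indic_xi R d N a (kappa / (4 * b) * V).
have mO := @rmeas_indicOm R d N.
have OmL : z * expR (kappa / 2 * n) <= fine (Zmass N a b Om).
  rewrite -lee_fin -Zmass_fin//.
  have ZO := Zmass_OmegaPlus_ge d3 b0 h0 gI gB T0.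
  apply: le_trans ZO.
  rewrite lee_fin ler_pM2l// ler_expR; lra.
have mAO := rmeas_indicI mA mO.
have mBO := rmeas_indicI (rmeas_indicC mA) mO.
have mT : rmeas (\1_(@setT (field R d)) : _ -> R) by rewrite indicT; exact: (rmeas_cst 1).
have zO : fine (Zmass N a b Om) = fine (Zmass N a b (A `&` Om)) +
    fine (Zmass N a b (~` A `&` Om)).
  by apply: EFin_inj; rewrite EFinD -!Zmass_fin//; exact: ZmassD.
have OmT : fine (Zmass N a b Om) <= fine (Zmass N a b (@setT (field R d))).
  have : (Zmass N a b Om <= Zmass N a b (@setT (field R d)))%E.
    by rewrite (ZmassD N a b mO mT) setIT leeDl// Zmass_ge0.
  by rewrite (Zmass_fin N a d3 b0 mO) (Zmass_fin N a d3 b0 mT).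
have zB : fine (Zmass N a b (~` A `&` Om)) <= expR (kappa / 4 * V) * z.
  rewrite -lee_fin -Zmass_fin// (_ : kappa / 4 * V = b * (kappa / (4 * b) * V)); last first.
    by field; rewrite gt_eqF.
  apply: Zmass_le => // phi [/negP]; rewrite -leNgt; exact.
have zO0 : 0 < fine (Zmass N a b Om) by apply: lt_le_trans OmL; rewrite mulr_gt0 ?expR_gt0.
have zT0 : 0 < fine (Zmass N a b (@setT (field R d))) by exact: lt_le_trans OmT.
(* The normalization of [Ptilde] cancels, so only masses inside [Om] are compared. *)
rewrite /Pcond /Ptilde invfM invrK mulrACA mulVf ?gt_eqF// mulr1 -/Om.
rewrite ler_pdivlMr// mulrBl mul1r lerBlDr {1}zO lerD2l; apply: (le_trans zB).
apply: (@le_trans _ _ (expR (- (kappa / 4 * V)) * (z * expR (kappa / 2 * n)))); last first.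
  by rewrite ler_wpM2l ?expR_ge0.
rewrite mulrCA -expRD mulrC ler_pM2l// ler_expR.
have : kappa * V <= kappa * n by rewrite ler_pM2l.
lra.
Qed.
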